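(* Let $r>0$, and fix $q\in[0,r)$ and $R>0$. There exists a positive constant $C_4>0$ such that for all $n,p$ with $2\log p<n$ and $R^2<(p-1)n^{-q}/2$, $$\inf_{\hat L}\ \sup_{\Sigma\in\mathcal{G}_q(R)}\ \mathbb{E}_\Sigma\Big[\big(\hat L-\ell_r(\Sigma)\big)^2\Big]\ \ge\ C_4\,\tilde\phi_{n,p}(q,R),$$ where $$\tilde\phi_{n,p}(q,R)=R^2\,\frac{\log p}{n}\ \vee\ \left\{R^2\left(\frac{\log\big(\frac{p-1}{R^2n^q}+1\big)}{2n}\right)^{r-q}\wedge R^{2r/q}\wedge 1\right\},$$ and the infimum is taken over all measurable functions $\hat L$ of the sample $X_1,\dots,X_n$.
   Context: $a\vee b=\max(a,b)$, $a\wedge b=\min(a,b)$; $n,p$ are positive integers. $\mathbf{S}_p^+$ is the set of $p\times p$ real symmetric positive semi-definite matrices. For $\Sigma=(\sigma_{ij})$, the $\ell_r$ functional is $\ell_r(\Sigma)=\max_{i\le p}\sum_{j\le p}|\sigma_{ij}|^r$. For $q\in[0,r)$ and $R>0$, $$\mathcal{G}_q(R)=\Big\{\Sigma\in\mathbf{S}_p^+:\ \max_{i\le p}\sum_{j\le p}|\sigma_{ij}|^q\le R,\ \mathrm{diag}(\Sigma)=I_p\Big\},$$ where $\mathrm{diag}(\Sigma)$ is $\Sigma$ with off-diagonal entries set to $0$, and for $q=0$, $|x|^0$ means $1$ if $x\ne0$ and $0$ if $x=0$. The sample $X_1,\dots,X_n$ consists of i.i.d. $\mathcal{N}(0,\Sigma)$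 vectors in $\mathbb{R}^p$ and $\mathbb{E}_\Sigma$ is the expectation under this law.
   Formalization: The formal theorem assumes that G_q(R) contains a matrix other than the identity (R > 1 if q > 0, R ≥ 2 if q = 0); otherwise the class is empty or {I}, the minimax risk is not positive, and the claimed bound fails. *)

(* Defs.v *)
From HB Require Import structures.
From mathcomp Require Import all_boot all_order all_algebra.
From mathcomp Require Import all_classical all_reals all_analysis.

Set Implicit Arguments.
Unset Strict Implicit.
Unset Printing Implicit Defensive.

Import Order.TTheory GRing.Theory Num.Theory.
Import numFieldNormedType.Exports.

Local Open Scope classical_set_scope.
Local Open Scope ring_scope.

(* |x|^s with the convention |0|^0 = 0, whereas the library's 0 `^ 0 is 1. *)
Definition abs_pow (R : realType) (s x : R) : R :=
  if x == 0 then 0 else `|x| `^ s.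

(* The sums are nonnegative, so the default value 0 of the maximum is harmless
   for p > 0. *)
Definition ell (R : realType) (p : nat) (s : R) (Sigma : 'M[R]_p) : R :=
  \big[Num.max/0]_(i < p) \sum_(j < p) abs_pow s (Sigma i j).

Definition psd (R : realType) (p : nat) : set 'M[R]_p :=
  [set Sigma | Sigma^T = Sigma /\
    forall u : 'rV[R]_p, 0 <= (u *m Sigma *m u^T) 0 0].

Definition G (R : realType) (p : nat) (q Rad : R) : set 'M[R]_p :=
  [set Sigma | [/\ psd Sigma,
    ell q Sigma <= Rad
  & diag_mx (\row_i Sigma i i) = 1%:M]].

(* The centred normal law on the line with variance v. The case v = 0 is
   separate because normal_prob m 0 is not the point mass at m. *)
Definition normal1 (R : realType) (v : R) (A : set R) : \bar R :=
  if v == 0 then \d_(0 : R) A else normal_prob 0 (Num.sqrt v) A.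

(* mu is N(0, Sigma), with Sigma possibly singular: every linear functional
   u . X of X ~ mu has the law N(0, u Sigma u^T). *)
Definition gaussian (R : realType) (p : nat) (Sigma : 'M[R]_p)
    (mu : probability (p.-tuple R) R) : Prop :=
  forall (u : 'rV[R]_p) (A : set R), measurable A ->
    mu [set x | A (\sum_(j < p) u 0 j * tnth x j)] =
    normal1 ((u *m Sigma *m u^T) 0 0) A.

(* P is the joint law of a sample of n independent N(0, Sigma) vectors: the
   n-fold product measure, characterized by its values on rectangles. *)
Definition gaussian_sample (R : realType) (n p : nat) (Sigma : 'M[R]_p)
    (P : probability (n.-tuple (p.-tuple R)) R) : Prop :=
  exists2 mu : probability (p.-tuple R) R, gaussian Sigma mu &
    forall A : 'I_n -> set (p.-tuple R), (forall i, measurable (A i)) ->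
      P [set x | forall i, A i (tnth x i)] = (\prod_(i < n) mu (A i))%E.

(* Sigma determines the law P, so that the supremum over the pairs (Sigma, P)
   is the supremum over Sigma of the expectation under the law of the sample. *)
Definition max_risk (R : realType) (n p : nat) (r q Rad : R)
    (L : n.-tuple (p.-tuple R) -> R) : \bar R :=
  ereal_sup [set e | exists Sigma : 'M[R]_p,
    exists P : probability (n.-tuple (p.-tuple R)) R,
    [/\ G q Rad Sigma, gaussian_sample Sigma P
      & e = ('E_P[(fun x => (L x - ell r Sigma) ^+ 2)%R])%E]].

Definition minimax_risk (R : realType) (n p : nat) (r q Rad : R) : \bar R :=
  ereal_inf [set max_risk r q Rad L |
    L in [set L : n.-tuple (p.-tuple R) -> R | measurable_fun setT L]].

(* For q = 0 the library gives Rad `^ (2 * r / 0) = Rad `^ 0 = 1, so the term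
   drops out of the minimum with 1, as under the convention
   Rad `^ (2 * r / 0) = +oo for Rad > 1. *)
Definition phi (R : realType) (n p : nat) (r q Rad : R) : R :=
  Num.max (Rad ^+ 2 * (ln p%:R / n%:R))
    (Num.min
      (Rad ^+ 2 *
        (ln ((p%:R - 1) / (Rad ^+ 2 * n%:R `^ q) + 1) / (2 * n%:R)) `^ (r - q))
      (Num.min (Rad `^ (2 * r / q)) 1)).

(* Main.v *)
Require Import Defs.
From HB Require Import structures.
From mathcomp Require Import all_boot all_order all_algebra.
From mathcomp Require Import all_classical all_reals all_analysis.
From mathcomp Require Import measurable_realfun ring lra.

(** Only two least favourable families are needed, both made of a vector with
    coordinates [X_i = b_i X_(par i) + sqrt (1 - b_i ^ 2) Z_i] for independent
    standard normal [Z], so that positive semi-definiteness is automatic.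

    For the term [log p / n], the coordinates are grouped in [K = p / 2] pairs of
    correlation [rho], and one unknown pair has correlation [rho + d] with
    [d ^ 2] of order [log p / n]; this moves [ell_r] by a multiple of [d].

    For the sparse term, all coordinates are independent except that [k] unknown
    ones, one in each of [k] blocks of size [m], are regressed on a common centre
    with coefficient [dl]; then [ell_r = 1 + k dl ^ r]. The likelihood ratio of
    two such stars has a conditional second moment, given the sample of the
    centre, which is a power of the number of common leaves; it is averaged over
    the blocks after restriction to the event that the centre has empirical
    second moment at most [8]. Without this restriction the chi-square divergence
    is infinite when [k dl ^ 2] is large, which happens for [q > 2].

    Both lower bounds follow from the comparison of the base law with the mixture
    of the alternatives: for an estimator [x] and the mixture density [W],
    [(x - l0) ^ 2 + W (x - l1) ^ 2 >= (l1 - l0) ^ 2 W / (1 + W)], and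
    [W / (1 + W) >= 2 c W - c ^ 2 W (1 + W)] involves only two moments of [W]. *)

Set Implicit Arguments.
Unset Strict Implicit.
Unset Printing Implicit Defensive.

Import Order.TTheory GRing.Theory Num.Theory.
Import numFieldNormedType.Exports.

Local Open Scope classical_set_scope.
Local Open Scope ring_scope.

(** * Densities and product probabilities *)

Section density.
Local Open Scope ereal_scope.
Context d (T : measurableType d) (R : realType).
Variables (nu mu : {measure set T -> \bar R}) (g : T -> R).
Hypotheses (mg : measurable_fun setT g) (g0 : forall x, (0 <= g x)%R).
Hypothesis nuE : forall A, measurable A -> nu A = \int[mu]_(x in A) (g x)%:E.

Import HBNNSimple.

(** By monotone convergence along simple approximations of [f]; for a simple function the measure of
    each level set is rewritten by [nuE]. *)
Lemma ge0_integral_density (f : T -> \bar R) :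
  measurable_fun setT f -> (forall x, 0 <= f x) ->
  \int[nu]_x f x = \int[mu]_x (f x * (g x)%:E).
Proof.
move=> mf f0; pose f_ := nnsfun_approx measurableT mf.
have f_cvg x : (f_ n x)%:E @[n --> \oo] --> f x by exact: cvg_nnsfun_approx.
have f_nd x : {homo (fun n => (f_ n x)%:E) : m n / (m <= n)%N >-> m <= n}.
  by move=> m n mn; rewrite lee_fin; exact/lefP/nd_nnsfun_approx.
transitivity (limn (fun n => \int[nu]_x (f_ n x)%:E)).
  rewrite -monotone_convergence//.
  - by apply: eq_integral => x _; apply/esym/cvg_lim.
  - by move=> n; exact/measurable_EFinP.
  - by move=> n x _; rewrite lee_fin.
transitivity (limn (fun n => \int[mu]_x ((f_ n x)%:E * (g x)%:E))); last first.
  rewrite -monotone_convergence//.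
  - apply: eq_integral => x _; apply/cvg_lim => //.
    exact: cvgeZr.
  - by move=> n; apply: emeasurable_funM; exact/measurable_EFinP.
  - by move=> n x _; rewrite mule_ge0// lee_fin.
  - by move=> x _ m n mn; rewrite lee_wpmul2r ?lee_fin//; exact: f_nd.
congr (limn _); apply/funext => n.
transitivity (\sum_(k \in range (f_ n)) (k%:E * nu (f_ n @^-1` [set k]))).
  by rewrite integralT_nnsfun sintegralE.
transitivity (\int[mu]_x (\sum_(k \in range (f_ n))
    (k * \1_(f_ n @^-1` [set k]) x)%:E * (g x)%:E)); last first.
  apply: eq_integral => x _; rewrite -ge0_mule_fsuml.
    by rewrite fsumEFin// -fimfunE.
  by move=> k; rewrite EFinM nnfun_muleindic_ge0.
rewrite ge0_integral_fsum//; last 2 first.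
- move=> k; apply: emeasurable_funM; last exact/measurable_EFinP.
  by apply/measurable_EFinP; apply: measurable_funM.
- move=> k x _; rewrite mule_ge0//; last by rewrite lee_fin.
  by rewrite EFinM nnfun_muleindic_ge0.
apply: eq_fsbigr => k /set_mem/= [x _ <-].
rewrite nuE//.
under [RHS]eq_integral do rewrite EFinM -muleA.
rewrite ge0_integralZl//; last 3 first.
- by apply: emeasurable_funM; apply/measurable_EFinP.
- by move=> y _; rewrite mule_ge0 ?lee_fin.
- by rewrite lee_fin.
congr (_ * _).
rewrite integral_mkcond; apply: eq_integral => y _.
rewrite patchE indicE; case: ifPn => _; first by rewrite mul1e.
by rewrite mul0e.
Qed.

End density.

Lemma integral_probability_cst d (T : measurableType d) (R : realType)
  (P : probability T R) (c : \bar R) : (\int[P]_x c = c)%E.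
Proof. by rewrite integral_cst//= probability_setT mule1. Qed.

Section integral_EFin.
Context d (T : measurableType d) (R : realType).
Variable mu : {measure set T -> \bar R}.

Lemma ge0_integralD_real (f g : T -> R) :
  measurable_fun setT f -> measurable_fun setT g ->
  (forall x, 0 <= f x) -> (forall x, 0 <= g x) ->
  (\int[mu]_x (f x + g x)%:E = \int[mu]_x (f x)%:E + \int[mu]_x (g x)%:E)%E.
Proof.
move=> mf mg f0 g0; rewrite -ge0_integralD//.
- by move=> x _; rewrite lee_fin.
- exact/measurable_EFinP.
- by move=> x _; rewrite lee_fin.
- exact/measurable_EFinP.
Qed.

Lemma ge0_integralZl_real (k : R) (f : T -> R) :
  measurable_fun setT f -> (forall x, 0 <= f x) -> 0 <= k ->
  (\int[mu]_x (k * f x)%:E = k%:E * \int[mu]_x (f x)%:E)%E.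
Proof.
move=> mf f0 k0; rewrite -ge0_integralZl//.
- exact/measurable_EFinP.
- by move=> x _; rewrite lee_fin.
Qed.

End integral_EFin.

(** * Product measures on tuples *)

Section product_probability.
Local Open Scope ereal_scope.
Context d (T : measurableType d) (R : realType).

Definition cons_tuple n (z : T * n.-tuple T) : n.+1.-tuple T :=
  [tuple of z.1 :: z.2].

Lemma measurable_cons_tuple n : measurable_fun setT (@cons_tuple n).
Proof. by apply: measurable_cons. Qed.

HB.instance Definition _ n :=
  isMeasurableFun.Build _ _ _ _ (@cons_tuple n) (@measurable_cons_tuple n).

(** The recursive form, a product pushed forward along [cons_tuple], lets Tonelli's theorem split
    off one coordinate at a time. *)
Fixpoint iid (P : probability T R) n : probability (n.-tuple T) R :=
  if n is m.+1 then distribution (P \x iid P m)%E (@cons_tuple m)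
  else \d_([tuple] : 0.-tuple T).

Lemma integral_iid0 (P : probability T R) (f : 0.-tuple T -> \bar R) :
  measurable_fun setT f -> \int[iid P 0]_t f t = f [tuple].
Proof. by move=> mf; rewrite /= integral_dirac// diracT mul1e. Qed.

Lemma integral_iidS (P : probability T R) n (f : n.+1.-tuple T -> \bar R) :
  measurable_fun setT f -> (forall t, 0 <= f t) ->
  \int[iid P n.+1]_t f t = \int[P]_x \int[iid P n]_t f [tuple of x :: t].
Proof.
move=> mf f0; rewrite /= ge0_integral_distribution// fubini_tonelli1//; last first.
  by move=> x /=.
exact: measurableT_comp.
Qed.

Lemma measurable_rectangle n (A : 'I_n -> set T) :
  (forall i, measurable (A i)) ->
  measurable [set t : n.-tuple T | forall i, A i (tnth t i)].
Proof.
move=> mA.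
rewrite (_ : [set t | _] = \bigcap_(i in [set: 'I_n])
    ((fun t : n.-tuple T => tnth t i) @^-1` A i)); last first.
  by apply/seteqP; split => [t /= At i _|t /= At i]; exact: At.
apply: fin_bigcap_measurable => // i _.
by rewrite -[X in measurable X]setTI; exact: measurable_tnth.
Qed.

(** Values on rectangles are what [gaussian_sample] asks of the law of a sample. *)
Lemma iid_rectangle (P : probability T R) n (A : 'I_n -> set T) :
  (forall i, measurable (A i)) ->
  iid P n [set t | forall i, A i (tnth t i)] = \prod_(i < n) P (A i).
Proof.
elim: n A => [|n IHn] A mA.
  by rewrite big_ord0 /= diracE mem_set// => -[].
rewrite big_ord_recl -(IHn (fun i => A (lift ord0 i)))//.
rewrite /= /distribution /pushforward -product_measure1E//; last first.
  exact: (measurable_rectangle (A := fun i => A (lift ord0 i))).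
congr (_ _); apply/seteqP; split => [[x t] /= At|[x t] /= [Ax At] i].
  split; first exact: (At ord0).
  by move=> i; have := At (lift ord0 i); rewrite tnthS.
case: (unliftP ord0 i) => [j|] ->; first by rewrite tnthS.
by [].
Qed.

Lemma measurable_prod_tnth n (h : T -> R) : measurable_fun setT h ->
  measurable_fun setT (fun t : n.-tuple T => (\prod_(i < n) h (tnth t i))%R).
Proof.
move=> mh; apply: measurable_prod => i _.
by apply: (measurableT_comp mh); exact: measurable_tnth.
Qed.

(** Independence, used to reduce moments of the likelihood ratio of a sample to those of one
    observation. *)
Lemma integral_iid_prod (P : probability T R) n (h : T -> R) (c : R) :
  measurable_fun setT h -> (forall x, (0 <= h x)%R) ->
  \int[P]_x (h x)%:E = c%:E ->
  \int[iid P n]_t (\prod_(i < n) h (tnth t i))%:E = (c ^+ n)%:E.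
Proof.
move=> mh h0 hc.
have c0 : (0 <= c)%R.
  by rewrite -lee_fin -hc; apply: integral_ge0 => x _; rewrite lee_fin.
elim: n => [|n IHn].
  rewrite integral_iid0 ?big_ord0//.
  by apply/measurable_EFinP; exact: measurable_prod_tnth.
rewrite integral_iidS; last 2 first.
- by apply/measurable_EFinP; exact: measurable_prod_tnth.
- by move=> t; rewrite lee_fin prodr_ge0.
under eq_integral => x _.
  under eq_integral => t _.
    rewrite big_ord_recl EFinM tnth0.
    under eq_bigr do rewrite tnthS.
    over.
  rewrite ge0_integralZl//=; last 3 first.
  - by apply/measurable_EFinP; exact: measurable_prod_tnth.
  - by move=> t _; rewrite lee_fin prodr_ge0.
  - by rewrite lee_fin.
  rewrite IHn.
  over.
rewrite ge0_integralZr//=; last 3 first.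
- exact/measurable_EFinP.
- by move=> x _; rewrite lee_fin.
- by rewrite lee_fin exprn_ge0.
by rewrite hc -EFinM exprS.
Qed.

End product_probability.

(** * Change of measure for product laws *)

Section change_of_measure.
Local Open Scope ereal_scope.
Context d d' (T : measurableType d) (T' : measurableType d') (R : realType).
Variables (P : probability T R) (P' : probability T' R).
Variables (phi : T -> T') (w : T -> R).
Hypotheses (mphi : measurable_fun setT phi) (mw : measurable_fun setT w).
Hypothesis w0 : forall x, (0 <= w x)%R.
Hypothesis P'E : forall f : T' -> \bar R, measurable_fun setT f ->
  (forall y, 0 <= f y) -> \int[P']_y f y = \int[P]_x (f (phi x) * (w x)%:E).

Lemma measurable_map_tuple n :
  measurable_fun setT (fun t : n.-tuple T => [tuple of map phi t]).
Proof.
apply/measurable_fun_tnthP => i.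
rewrite (_ : _ \o _ = fun t => phi (tnth t i)); last first.
  by apply/funext => t /=; rewrite tnth_map.
by apply: (measurableT_comp mphi); exact: measurable_tnth.
Qed.

(** Here [P'] is the image under [phi] of the measure with density [w]; Tonelli's theorem carries
    this relation over to samples. All laws compared later are thereby weighted versions of one law
    on one space. *)
Lemma integral_iid_change n (F : n.-tuple T' -> \bar R) :
  measurable_fun setT F -> (forall t, 0 <= F t) ->
  \int[iid P' n]_t F t =
  \int[iid P n]_t (F [tuple of map phi t] * (\prod_(i < n) w (tnth t i))%:E).
Proof.
have mFw m (H : m.-tuple T' -> \bar R) : measurable_fun setT H ->
    measurable_fun setT (fun t : m.-tuple T =>
      H [tuple of map phi t] * (\prod_(i < m) w (tnth t i))%:E).
  move=> mH; apply: emeasurable_funM.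
    by apply: (measurableT_comp mH); exact: measurable_map_tuple.
  by apply/measurable_EFinP; exact: measurable_prod_tnth.
have Fw0 m (H : m.-tuple T' -> \bar R) : (forall t, 0 <= H t) ->
    forall t : m.-tuple T,
      0 <= H [tuple of map phi t] * (\prod_(i < m) w (tnth t i))%:E.
  by move=> H0 t; rewrite mule_ge0// lee_fin prodr_ge0.
elim: n F => [|n IHn] F mF F0.
  rewrite !integral_iid0//; last exact: mFw.
  by rewrite big_ord0 mule1; congr F; exact: val_inj.
rewrite !integral_iidS//; last 2 first.
- exact: mFw.
- exact: Fw0.
have mFc : measurable_fun setT (fun z : T' * n.-tuple T' => F [tuple of z.1 :: z.2]).
  by apply: (measurableT_comp mF); exact: measurable_cons.
rewrite P'E; last 2 first.
- exact: (@measurable_fun_fubini_tonelli_F _ _ _ _ _ (iid P' n)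
    (fun z => F [tuple of z.1 :: z.2])).
- by move=> y; apply: integral_ge0.
apply: eq_integral => x _.
rewrite IHn//; last exact: (measurableT_comp mF (measurable_cons _ _)).
rewrite -ge0_integralZr//; last 3 first.
- apply: (mFw _ (fun t => F [tuple of phi x :: t])).
  exact: (measurableT_comp mF (measurable_cons _ _)).
- by move=> t _; apply: (Fw0 _ (fun t => F [tuple of phi x :: t])).
- by rewrite lee_fin.
apply: eq_integral => t _.
rewrite big_ord_recl tnth0 EFinM (muleC (w x)%:E) muleA.
under [in RHS]eq_bigr do rewrite tnthS.
congr (F _ * _ * _); exact: val_inj.
Qed.

End change_of_measure.

(** * Gaussian integrals on the line *)

Section affine_lebesgue.
Local Open Scope ereal_scope.
Context (R : realType).
Notation mu := (@lebesgue_measure R).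

Definition affine (m s y : R) : R := (m + s * y)%R.

Lemma measurable_affine m s : measurable_fun setT (affine m s).
Proof. by apply: measurable_funD => //; exact: measurable_funM. Qed.

HB.instance Definition _ m s :=
  isMeasurableFun.Build _ _ _ _ (affine m s) (measurable_affine m s).

Definition affine_image m s := pushforward mu (affine m s : _ -> measurableTypeR R).

Let affine_image0 m s : affine_image m s set0 = 0.
Proof. by rewrite /affine_image /pushforward preimage_set0 measure0. Qed.

Let affine_image_ge0 m s A : 0 <= affine_image m s A.
Proof. by rewrite /affine_image /pushforward measure_ge0. Qed.

Let affine_image_sigma_additive m s : semi_sigma_additive (affine_image m s).
Proof.
rewrite /affine_image.
apply: measure_semi_sigma_additive; exact: measurable_affine.
Qed.

HB.instance Definition _ m s := isMeasure.Build _ _ _ (affine_image m s)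
  (affine_image0 m s) (affine_image_ge0 m s) (@affine_image_sigma_additive m s).

(** By uniqueness of Lebesgue measure it suffices to compare both sides on half-open intervals. *)
Lemma lebesgue_measure_affine (m s : R) (A : set R) : (s != 0)%R ->
  measurable A -> mu A = `|s|%:E * mu (affine m s @^-1` A).
Proof.
move=> s0 mA.
rewrite -[RHS]/(mscale (NngNum (normr_ge0 s)) (affine_image m s) A).
apply: (@lebesgue_measure_unique R (mscale (NngNum (normr_ge0 s)) (affine_image m s))) => // _ [[a b]] _ <-.
rewrite -[RHS]/(`|s|%:E * mu (affine m s @^-1` `]a, b])).

have [s_lt0|s_gt0|s00] := ltgtP s 0%R; last by rewrite s00 eqxx in s0.
(* A negative slope reverses the endpoints, so the preimage of []a, b]] is closed on the left and
   open on the right. *)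
- rewrite [X in _ * X](_ : _ = mu `[((b - m) / s)%R, ((a - m) / s)%R[%classic); last first.
    congr (mu _); apply/seteqP; split => y /=; rewrite !in_itv/= /affine.
      by rewrite ler_ndivrMr// ltr_ndivlMr// => /andP[? ?]; apply/andP; split; lra.
    by rewrite ler_ndivrMr// ltr_ndivlMr// => /andP[? ?]; apply/andP; split; lra.
  rewrite !lebesgue_measure_itv/= !lte_fin ltr_nM2r ?invr_lt0// ltrD2r.
  case: ifPn => _; last by rewrite mule0.
  rewrite -!EFinD -EFinM; congr EFin; rewrite ltr0_norm//; field.
  by rewrite lt_eqF.
- rewrite [X in _ * X](_ : _ = mu `]((a - m) / s)%R, ((b - m) / s)%R]%classic); last first.
    congr (mu _); apply/seteqP; split => y /=; rewrite !in_itv/= /affine.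
      by rewrite ltr_pdivrMr// ler_pdivlMr// => /andP[? ?]; apply/andP; split; lra.
    by rewrite ltr_pdivrMr// ler_pdivlMr// => /andP[? ?]; apply/andP; split; lra.
  rewrite !lebesgue_measure_itv/= !lte_fin ltr_pM2r ?invr_gt0// ltrD2r.
  case: ifPn => _; last by rewrite mule0.
  rewrite -!EFinD -EFinM; congr EFin; rewrite gtr0_norm//; field.
  by rewrite gt_eqF.
Qed.

Lemma integral_lebesgue_affine (m s : R) (f : R -> \bar R) : (s != 0)%R ->
  measurable_fun setT f -> (forall x, 0 <= f x) ->
  \int[mu]_x f x = `|s|%:E * \int[mu]_y f (affine m s y).
Proof.
move=> s0 mf f0.
transitivity (\int[mscale (NngNum (normr_ge0 s))
    (affine_image m s)]_x f x).
  by apply: eq_measure_integral => A mA _; exact: lebesgue_measure_affine.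
rewrite ge0_integral_mscale//= ge0_integral_pushforward//=.
exact: measurable_affine.
Qed.

End affine_lebesgue.

Section gauss.
Context (R : realType).
Notation mu := (@lebesgue_measure R).

(* [R] and [measurableTypeR R], which carries [normal_prob], have the same
   measurable sets but are not convertible as measurable types. *)
Definition to_real (x : measurableTypeR R) : R := x.

Let measurable_to_real : measurable_fun setT to_real.
Proof. by move=> _ A mA; rewrite setTI. Qed.

HB.instance Definition _ :=
  isMeasurableFun.Build _ _ _ _ to_real measurable_to_real.

Definition gauss : probability R R := distribution (normal_prob 0 1) to_real.

Lemma integral_gauss (f : R -> \bar R) :
  measurable_fun setT f -> (forall x, 0 <= f x)%E ->
  (\int[gauss]_x f x = \int[normal_prob 0 1]_x f x)%E.
Proof. by move=> mf f0; rewrite /gauss ge0_integral_distribution. Qed.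

Lemma integral_normal (m s : R) (f : R -> \bar R) :
  measurable_fun setT f -> (forall x, 0 <= f x)%E ->
  (\int[normal_prob m s]_x f x = \int[mu]_x (f x * (normal_pdf m s x)%:E))%E.
Proof.
move=> mf f0; apply: ge0_integral_density => //.
- exact: measurable_normal_pdf.
- exact: normal_pdf_ge0.
Qed.

(** With the scale split off the normalizing constant, identities between Gaussian densities reduce
    to identities between exponents. *)
Lemma normal_pdf_exp (m s x : R) : (s != 0)%R -> normal_pdf m s x =
  (`|s|^-1 * ((Num.sqrt (pi *+ 2))^-1 * expR (- ((x - m) / s) ^+ 2 / 2)))%R.
Proof.
move=> s0; rewrite normal_pdfE// /normal_peak /normal_fun -mulrnAr.
rewrite sqrtrM ?sqr_ge0// sqrtr_sqr invfM -mulrA; congr (_ * (_ * expR _))%R.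
by rewrite -mulr_natr; field.
Qed.

Lemma normal_pdf_norm (m s x : R) : normal_pdf m `|s| x = normal_pdf m s x.
Proof.
have [->|s0] := eqVneq s 0%R; first by rewrite normr0.
rewrite !normal_pdf_exp ?normr_eq0// normr_id.
by rewrite !expr_div_n real_normK ?num_real.
Qed.

Lemma integral_gauss_affine (m s : R) (f : R -> \bar R) : (s != 0)%R ->
  measurable_fun setT f -> (forall x, 0 <= f x)%E ->
  (\int[gauss]_y f (affine m s y) = \int[normal_prob m s]_x f x)%E.
Proof.
move=> s0 mf f0; have mfa : measurable_fun setT (fun y => f (affine m s y)).
  exact: measurableT_comp.
rewrite (integral_gauss mfa (fun y => f0 _)).
rewrite (integral_normal 0 1 mfa (fun y => f0 _)) (integral_normal m s mf f0).
have mfp : measurable_fun setT (fun x => f x * (normal_pdf m s x)%:E)%E.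
  apply: emeasurable_funM => //; apply/measurable_EFinP.
  exact: measurable_normal_pdf.
have fp0 x : (0 <= f x * (normal_pdf m s x)%:E)%E.
  by rewrite mule_ge0// lee_fin normal_pdf_ge0.
rewrite (integral_lebesgue_affine m s0 mfp fp0) -ge0_integralZl//=; last first.
  exact: (measurableT_comp mfp (measurable_affine m s)).
apply: eq_integral => y _; rewrite muleCA -EFinM; congr (_ * _%:E)%E.
rewrite !normal_pdf_exp ?oner_eq0// normr1 invr1 mul1r mulrA divff ?normr_eq0//.
rewrite mul1r; congr (_ * expR _)%R; rewrite /affine; by field.
Qed.

(** The likelihood ratio of the normal law with mean [m] and standard deviation [s] to the standard
    one. *)
Definition gauss_ratio (m s y : R) : R :=
  (normal_pdf m s y / normal_pdf 0 1 y)%R.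

Lemma normal_pdf_gt0 (m s x : R) : (s != 0)%R -> (0 < normal_pdf m s x)%R.
Proof.
move=> s0; rewrite normal_pdfE// mulr_gt0 ?expR_gt0//; exact: normal_peak_gt0.
Qed.

Lemma gauss_ratio_ge0 (m s y : R) : (0 <= gauss_ratio m s y)%R.
Proof. by rewrite divr_ge0// normal_pdf_ge0. Qed.

Lemma gauss_ratioE (m s y : R) : (0 < s)%R ->
  gauss_ratio m s y = (s^-1 * expR (y ^+ 2 / 2 - ((y - m) / s) ^+ 2 / 2))%R.
Proof.
move=> s0; rewrite /gauss_ratio !normal_pdf_exp ?oner_eq0 ?gt_eqF//.
rewrite gtr0_norm// normr1 invr1 mul1r subr0 mulr1 expRD.
have c0 : (Num.sqrt (pi *+ 2))^-1 != 0%R :> R.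
  by rewrite invr_eq0 sqrtr_eq0 -ltNge mulrn_wgt0// pi_gt0.
rewrite mulNr expRN mulNr expRN.
have e0 := lt0r_neq0 (expR_gt0 (y ^+ 2 / 2)).
have e1 := lt0r_neq0 (expR_gt0 (((y - m) / s) ^+ 2 / 2)).
set u := expR _ in e1 *; set v := expR _ in e0 *; set c := (_^-1)%R in c0 *.
field; by rewrite e0 e1 c0 gt_eqF.
Qed.

Lemma measurable_gauss_ratio d (T : measurableType d) (a b : T -> R) (s : R) :
  (0 < s)%R -> measurable_fun setT a -> measurable_fun setT b ->
  measurable_fun setT (fun t => gauss_ratio (a t) s (b t)).
Proof.
move=> s0 ma mb; under eq_fun do rewrite gauss_ratioE//.
apply: measurable_funM => //; apply: measurableT_comp => //.
apply: measurable_funB; apply: measurable_funM => //; apply: measurable_funX => //.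
by apply: measurable_funM => //; exact: measurable_funB.
Qed.

Lemma integral_gauss_ratio (m s : R) (f : R -> \bar R) : (0 < s)%R ->
  measurable_fun setT f -> (forall x, 0 <= f x)%E ->
  (\int[gauss]_y f (affine m s y) =
   \int[gauss]_y (f y * (gauss_ratio m s y)%:E))%E.
Proof.
move=> s0 mf f0.
have mfr : measurable_fun setT (fun y => f y * (gauss_ratio m s y)%:E)%E.
  by apply: emeasurable_funM => //; apply/measurable_EFinP; exact: measurable_gauss_ratio.
have fr0 y : (0 <= f y * (gauss_ratio m s y)%:E)%E.
  by rewrite mule_ge0// lee_fin gauss_ratio_ge0.
have s1 : s != 0 by rewrite gt_eqF.
rewrite (integral_gauss_affine m s1 mf f0) (integral_gauss mfr fr0).
rewrite (integral_normal m s mf f0) (integral_normal 0 1 mfr fr0).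
apply: eq_integral => y _; rewrite -muleA -EFinM; congr (_ * _%:E)%E.
by rewrite /gauss_ratio divfK// gt_eqF// normal_pdf_gt0// oner_eq0.
Qed.

(** Once completing the square has turned [h] times the standard density into [C] times another
    normal density, only the total mass one of the latter is needed. *)
Lemma integral_gauss_cst (h : R -> R) (C m s : R) :
  measurable_fun setT h -> (forall y, (0 <= h y)%R) -> 0 <= C ->
  (forall y, (h y * normal_pdf 0 1 y = C * normal_pdf m s y)%R) ->
  (\int[gauss]_y (h y)%:E = C%:E)%E.
Proof.
move=> mh h0 C0 hE; have mEh : measurable_fun setT (EFin \o h) by exact/measurable_EFinP.
rewrite (integral_gauss mEh)//= (integral_normal 0 1 mEh)//=.
under eq_integral do rewrite -EFinM hE EFinM.
rewrite ge0_integralZl//; last 2 first.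
- by apply/measurable_EFinP; exact: measurable_normal_pdf.
- by move=> y _; rewrite lee_fin normal_pdf_ge0.
by rewrite (@integral_normal_pdf R m s) mule1.
Qed.

Lemma integral_gauss_ratio1 (m s : R) : (0 < s)%R ->
  (\int[gauss]_y (gauss_ratio m s y)%:E = 1)%E.
Proof.
move=> s0; apply: (integral_gauss_cst (m := m) (s := s)) => //.
- exact: measurable_gauss_ratio.
- by move=> y; exact: gauss_ratio_ge0.
by move=> y; rewrite mul1r /gauss_ratio divfK// gt_eqF// normal_pdf_gt0// oner_eq0.
Qed.

(** Completing the square gives a normal density with mean [2 m / (2 - s ^ 2)] and variance
    [s ^ 2 / (2 - s ^ 2)], which is positive by the bound on [s]. *)
Lemma integral_gauss_ratio_sqr (m s : R) : (0 < s)%R -> (s ^+ 2 < 2)%R ->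
  (\int[gauss]_y (gauss_ratio m s y ^+ 2)%:E =
  (expR (m ^+ 2 / (2 - s ^+ 2)) / (s * Num.sqrt (2 - s ^+ 2)))%:E)%E.
Proof.
move=> s0 s2.
have D0 : (0 < 2 - s ^+ 2)%R by rewrite subr_gt0.
have Q0 : (0 < Num.sqrt (2 - s ^+ 2))%R by rewrite sqrtr_gt0.
apply: (@integral_gauss_cst _ _ (2 * m / (2 - s ^+ 2)) (s / Num.sqrt (2 - s ^+ 2))).
- by apply: measurable_funX; exact: measurable_gauss_ratio.
- by move=> y; rewrite sqr_ge0.
- by rewrite divr_ge0// ?expR_ge0// mulr_ge0 ?ltW.
move=> y; rewrite {1}expr2 -mulrA.
rewrite [X in (_ * X)%R](_ : _ = normal_pdf m s y); last first.
  by rewrite /gauss_ratio divfK// gt_eqF// normal_pdf_gt0// oner_eq0.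
have Q1 : Num.sqrt (2 - s ^+ 2) != 0%R by rewrite gt_eqF.
have s1 : s != 0%R by rewrite gt_eqF.
rewrite gauss_ratioE// !normal_pdf_exp ?mulf_neq0 ?invr_eq0//.
rewrite !gtr0_norm ?divr_gt0//.
have -> : ((y - 2 * m / (2 - s ^+ 2)) / (s / Num.sqrt (2 - s ^+ 2))) ^+ 2 =
   ((y - 2 * m / (2 - s ^+ 2)) / s) ^+ 2 * (2 - s ^+ 2) :> R.
  rewrite invfM invrK mulrA exprMn sqr_sqrtr//; exact: ltW.
have -> : expR (y ^+ 2 / 2 - ((y - m) / s) ^+ 2 / 2) =
    (expR (m ^+ 2 / (2 - s ^+ 2)) *
     expR (- (((y - 2 * m / (2 - s ^+ 2)) / s) ^+ 2 * (2 - s ^+ 2)) / 2) /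
     expR (- ((y - m) / s) ^+ 2 / 2))%R.
  rewrite -expRN -!expRD; congr expR.
  field; by rewrite s1 gt_eqF.
set e1 := expR _; set e2 := expR _; set e3 := expR (- _ / 2).
have e30 : e3 != 0%R by rewrite gt_eqF// expR_gt0.
set c := (Num.sqrt (pi *+ 2))^-1.
set Q := Num.sqrt _ in Q0 Q1 *.
field; by rewrite s1 Q1 e30.
Qed.

(** The exponential tilts the standard density into a multiple of the centred one with variance
    [1 / (1 - 2 th)]. *)
Lemma integral_gauss_exp_sqr (th : R) : (th < 1 / 2)%R ->
  (\int[gauss]_y (expR (th * y ^+ 2))%:E = ((Num.sqrt (1 - 2 * th))^-1)%:E)%E.
Proof.
move=> th2.
have D0 : (0 < 1 - 2 * th)%R by lra.
have Q0 : (0 < Num.sqrt (1 - 2 * th))%R by rewrite sqrtr_gt0.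
apply: (@integral_gauss_cst _ _ 0 (Num.sqrt (1 - 2 * th))^-1).
- apply: measurableT_comp => //; apply: measurable_funM => //.
- by move=> y; rewrite expR_ge0.
- by rewrite invr_ge0 ltW.
move=> y; rewrite !normal_pdf_exp ?oner_eq0 ?invr_eq0 ?gt_eqF//.
rewrite normr1 invr1 mul1r gtr0_norm ?invr_gt0// invrK [RHS]mulrA mulVf ?gt_eqF// mul1r.
rewrite mulrCA -expRD !subr0 mulr1 exprMn sqr_sqrtr ?ltW//; congr (_ * _).
by congr expR; field.
Qed.

(** For [x = b y + a z] with independent standard normal [y] and [z], the joint density of [x] and
    [y] is factored in its two ways into a marginal and a conditional density. *)
Lemma normal_pdf_convolution (a b x y : R) : (a != 0)%R ->
  (normal_pdf (b * y) a x * normal_pdf 0 1 y =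
   normal_pdf 0 (Num.sqrt (a ^+ 2 + b ^+ 2)) x *
   normal_pdf (b * x / (a ^+ 2 + b ^+ 2)) (a / Num.sqrt (a ^+ 2 + b ^+ 2)) y)%R.
Proof.
move=> a0.
have D0 : (0 < a ^+ 2 + b ^+ 2)%R.
  by rewrite ltr_pwDl ?sqr_ge0// exprn_even_gt0.
have Q0 : (0 < Num.sqrt (a ^+ 2 + b ^+ 2))%R by rewrite sqrtr_gt0.
have Q1 := lt0r_neq0 Q0.
rewrite !normal_pdf_exp ?mulf_neq0 ?invr_eq0 ?oner_eq0//.
rewrite normr1 invr1 mul1r normrM normfV !(gtr0_norm Q0) !invfM !invrK subr0 mulr1.
have -> : ((x - 0) / Num.sqrt (a ^+ 2 + b ^+ 2)) ^+ 2 = x ^+ 2 / (a ^+ 2 + b ^+ 2) :> R.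
  by rewrite subr0 expr_div_n sqr_sqrtr ?ltW.
have -> : ((y - b * x / (a ^+ 2 + b ^+ 2)) * (a^-1 * Num.sqrt (a ^+ 2 + b ^+ 2))) ^+ 2 =
    ((y - b * x / (a ^+ 2 + b ^+ 2)) / a) ^+ 2 * (a ^+ 2 + b ^+ 2) :> R.
  by rewrite mulrA exprMn sqr_sqrtr ?ltW.
set c := (Num.sqrt (pi *+ 2))^-1%R.
have -> : forall n e1 e2 : R, (n * (c * e1) * (c * e2) = n * c * c * (e1 * e2))%R.
  by move=> *; ring.
have -> : forall n q e1 e2 : R, q != 0 -> (q^-1 * (c * e1) * (n * q * (c * e2)) = n * c * c * (e1 * e2))%R.
  by move=> *; field.
congr (_ * _)%R; rewrite -!expRD; congr expR; field.
by rewrite a0 gt_eqF.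
by [].
Qed.

Lemma integral_gauss_scale_norm (s : R) (f : R -> \bar R) :
  measurable_fun setT f -> (forall x, 0 <= f x)%E ->
  (\int[gauss]_y f (s * y)%R = \int[gauss]_y f (`|s| * y)%R)%E.
Proof.
move=> mf f0; have [->|s0] := eqVneq s 0; first by rewrite normr0.
have affE a y : a * y = affine 0 a y by rewrite /affine add0r.
under eq_integral do rewrite affE.
under [in RHS]eq_integral do rewrite affE.
have s1 : `|s| != 0 by rewrite normr_eq0.
rewrite (integral_gauss_affine 0 s0 mf f0) (integral_gauss_affine 0 s1 mf f0).
rewrite (integral_normal 0 s mf f0) (integral_normal 0 `|s| mf f0).
by under [in RHS]eq_integral do rewrite normal_pdf_norm.
Qed.

Lemma integral_gauss_ratio_center (a b x : R) : 0 < b ->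
  (\int[gauss]_y (gauss_ratio (a * y)%R b x)%:E =
   (gauss_ratio 0 (Num.sqrt (a ^+ 2 + b ^+ 2)%R) x)%:E)%E.
Proof.
move=> b0; have b1 : b != 0 by rewrite gt_eqF.
apply: (@integral_gauss_cst _ _ (a * x / (b ^+ 2 + a ^+ 2))
  (b / Num.sqrt (b ^+ 2 + a ^+ 2))).
- by apply: measurable_gauss_ratio => //; exact: measurable_funM.
- by move=> y; exact: gauss_ratio_ge0.
- exact: gauss_ratio_ge0.
move=> y; rewrite /gauss_ratio mulrAC normal_pdf_convolution// mulrAC.
by rewrite (addrC (a ^+ 2)).
Qed.

(** Conditionally on [x] the sum is a reweighted standard normal variable; after Tonelli's theorem,
    averaging the weight over [x] gives the ratio of the marginal law. *)
Lemma integral_gauss_sum (a b : R) (f : R -> \bar R) : 0 <= b ->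
  measurable_fun setT f -> (forall x, 0 <= f x)%E ->
  (\int[gauss]_x \int[gauss]_y f (a * x + b * y)%R =
   \int[gauss]_y f (Num.sqrt (a ^+ 2 + b ^+ 2) * y)%R)%E.
Proof.
(* The degenerate case is separate because a likelihood ratio requires a positive scale. *)
move=> b_ge0 mf f0; have [b0|b1] := eqVneq b 0.
  rewrite b0 expr0n/= addr0 sqrtr_sqr -(integral_gauss_scale_norm _ mf f0).
  apply: eq_integral => x _; under eq_integral do rewrite mul0r addr0.
  exact: (integral_probability_cst gauss).
have b_gt0 : 0 < b by rewrite lt_neqAle eq_sym b1.
set c := Num.sqrt (a ^+ 2 + b ^+ 2).
have c_gt0 : 0 < c by rewrite sqrtr_gt0 ltr_wpDl ?sqr_ge0// exprn_gt0.
transitivity (\int[gauss]_x \int[gauss]_y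
    (f y * (gauss_ratio (a * x)%R b y)%:E))%E.
  by apply: eq_integral => x _; exact: integral_gauss_ratio.
have mh : measurable_fun setT (fun z : R * R =>
    f z.2 * (gauss_ratio (a * z.1)%R b z.2)%:E)%E.
  apply: emeasurable_funM; first exact: measurableT_comp.
  apply/measurable_EFinP; apply: measurable_gauss_ratio => //.
  exact: measurable_funM.
have h0 (z : R * R) : (0 <= f z.2 * (gauss_ratio (a * z.1)%R b z.2)%:E)%E.
  by rewrite mule_ge0// lee_fin gauss_ratio_ge0.
rewrite -(fubini_tonelli1 _ mh h0) (fubini_tonelli2 _ mh h0).
transitivity (\int[gauss]_y (f y * (gauss_ratio 0%R c y)%:E))%E.
  apply: eq_integral => y _; rewrite /fubini_G/= ge0_integralZl//; last 2 first.
  - apply/measurable_EFinP.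
    apply: (@measurable_gauss_ratio _ _ (fun x => a * x) (fun=> y)) => //.
    exact: measurable_funM.
  - by move=> x _; rewrite lee_fin gauss_ratio_ge0.
  by rewrite integral_gauss_ratio_center.
rewrite -integral_gauss_ratio//.
by apply: eq_integral => y _; rewrite /affine add0r.
Qed.

End gauss.

(** * Standard Gaussian vectors *)

Section resampling.
Local Open Scope ereal_scope.
Context d (T : measurableType d) (R : realType) (P : probability T R).

Definition upd p (z : p.-tuple T) (j : 'I_p) (y : T) : p.-tuple T :=
  [tuple (if i == j then y else tnth z i) | i < p].

Lemma tnth_upd p (z : p.-tuple T) j y i :
  tnth (upd z j y) i = if i == j then y else tnth z i.
Proof. by rewrite tnth_mktuple. Qed.

Lemma tnth_upd_same p (z : p.-tuple T) j y : tnth (upd z j y) j = y.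
Proof. by rewrite tnth_upd eqxx. Qed.

Lemma tnth_upd_neq p (z : p.-tuple T) j y i :
  i != j -> tnth (upd z j y) i = tnth z i.
Proof. by rewrite tnth_upd => /negbTE ->. Qed.

Lemma upd_upd p (z : p.-tuple T) j y y' : upd (upd z j y) j y' = upd z j y'.
Proof. by apply: eq_from_tnth => i; rewrite !tnth_upd; case: eqP. Qed.

Lemma measurable_upd d' (S : measurableType d') p (j : 'I_p)
    (a : S -> p.-tuple T) (b : S -> T) :
  measurable_fun setT a -> measurable_fun setT b ->
  measurable_fun setT (fun x => upd (a x) j (b x)).
Proof.
move=> ma mb; apply/measurable_fun_tnthP => i.
rewrite (_ : _ \o _ = fun x => if i == j then b x else tnth (a x) i); last first.
  by apply/funext => x /=; rewrite tnth_upd.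
case: (i == j) => //.
exact: (measurableT_comp (@measurable_tnth _ _ _ i) ma).
Qed.

Lemma upd_cons0 p x (t : p.-tuple T) y :
  upd [tuple of x :: t] ord0 y = [tuple of y :: t].
Proof.
apply: eq_from_tnth => i; rewrite tnth_upd.
by case: (unliftP ord0 i) => [k|] ->; rewrite ?tnthS// tnth0 eqxx.
Qed.

Lemma upd_consS p x (t : p.-tuple T) j y :
  upd [tuple of x :: t] (lift ord0 j) y = [tuple of x :: upd t j y].
Proof.
apply: eq_from_tnth => i; rewrite tnth_upd.
case: (unliftP ord0 i) => [k|] ->; last by rewrite !tnth0.
by rewrite !tnthS tnth_upd (inj_eq lift_inj).
Qed.

Lemma measurable_integral_upd p (j : 'I_p) (f : p.-tuple T -> \bar R) :
  measurable_fun setT f -> (forall z, 0 <= f z) ->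
  measurable_fun setT (fun z => \int[P]_y f (upd z j y)).
Proof.
move=> mf f0.
apply: (@measurable_fun_fubini_tonelli_F _ _ _ _ _ P
  (fun z : p.-tuple T * T => f (upd z.1 j z.2))) => //.
by apply: (measurableT_comp mf); exact: measurable_upd.
Qed.

(** Redrawing one coordinate independently preserves a product law. This gives access to the
    conditional law of a coordinate given all the others. *)
Lemma integral_resample p (j : 'I_p) (f : p.-tuple T -> \bar R) :
  measurable_fun setT f -> (forall z, 0 <= f z) ->
  \int[iid P p]_z f z = \int[iid P p]_z \int[P]_y f (upd z j y).
Proof.
elim: p j f => [[]//|p IHp] j f mf f0.
have mcons x : measurable_fun setT (fun t : p.-tuple T => f [tuple of x :: t]).
  by apply: (measurableT_comp mf); exact: measurable_cons.
rewrite !integral_iidS//; last 2 first.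
- exact: measurable_integral_upd.
- by move=> z; apply: integral_ge0.
case: (unliftP ord0 j) => [k|] ->; last first.
  under [in RHS]eq_integral => x _.
    under eq_integral => t _.
      under eq_integral do rewrite upd_cons0.
      over.
    over.
  (* The redrawn head has replaced [x], so the outer integral is that of a constant, and only the
     order of integration remains to be exchanged. *)
  rewrite integral_probability_cst.
  have mf' : measurable_fun setT
      (fun z : T * p.-tuple T => f [tuple of z.1 :: z.2]).
    by apply: (measurableT_comp mf); exact: measurable_cons.
  transitivity (\int[P \x iid P p]_z f [tuple of z.1 :: z.2]).
    by rewrite fubini_tonelli1.
  by rewrite fubini_tonelli2.
apply: eq_integral => x _; rewrite (IHp k)//.
by apply: eq_integral => t _; apply: eq_integral => y _; rewrite upd_consS.
Qed.

Lemma integral_iid_coord p (j : 'I_p) (f : T -> \bar R) :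
  measurable_fun setT f -> (forall x, 0 <= f x) ->
  \int[iid P p]_z f (tnth z j) = \int[P]_y f y.
Proof.
move=> mf f0; rewrite (integral_resample j)//; last first.
  by apply: (measurableT_comp mf); exact: measurable_tnth.
under eq_integral do under eq_integral do rewrite tnth_upd_same.
exact: integral_probability_cst.
Qed.

(** Parents lie outside [l], so given the coordinates outside [l] the factors are independent, and
    each is integrated out by resampling its own coordinate. *)
Lemma integral_iid_out p (l : seq 'I_p) (par : 'I_p -> 'I_p)
    (psi : p.-tuple T -> R) (h : 'I_p -> T -> T -> R) (H : 'I_p -> T -> R) :
  uniq l -> {in l, forall i, par i \notin l} ->
  measurable_fun setT psi -> (forall z, (0 <= psi z)%R) ->
  (forall z j y, j \in l -> psi (upd z j y) = psi z) ->
  (forall j, measurable_fun setT (fun z : T * T => h j z.1 z.2)) ->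
  (forall j x y, (0 <= h j x y)%R) ->
  (forall j, measurable_fun setT (H j)) -> (forall j x, (0 <= H j x)%R) ->
  (forall j x, \int[P]_y (h j x y)%:E = (H j x)%:E) ->
  \int[iid P p]_z (psi z *
     \prod_(j <- l) h j (tnth z (par j)) (tnth z j))%:E =
  \int[iid P p]_z (psi z * \prod_(j <- l) H j (tnth z (par j)))%:E.
Proof.
move=> + + + + + mh h0 mH H0 hH.
have mhj j : measurable_fun setT
    (fun z : p.-tuple T => h j (tnth z (par j)) (tnth z j)).
  apply: (@measurableT_comp _ _ _ _ _ _ (fun z => h j z.1 z.2) _
    (fun z : p.-tuple T => (tnth z (par j), tnth z j))) => //.
  by apply: measurable_fun_pair; exact: measurable_tnth.
have mHj j : measurable_fun setT (fun z : p.-tuple T => H j (tnth z (par j))).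
  by apply: (measurableT_comp (mH j)); exact: measurable_tnth.
elim: l psi => [|j l IHl] psi /=.
  by move=> _ _ _ _ _; apply: eq_integral => z _; rewrite !big_nil.
move=> /andP[jl ul] parl mpsi psi0 psiE.
have parjl : par j \notin j :: l by apply: parl; rewrite mem_head.
have /andP[parj parl'] : (par j != j) && (par j \notin l).
  by move: parjl; rewrite inE negb_or.
(* The factor of [j] is absorbed into [psi]: it is unaffected by updates in the tail, which contains
   neither [j] nor its parent. *)
transitivity (\int[iid P p]_z ((psi z * h j (tnth z (par j)) (tnth z j)) *
    \prod_(i <- l) H i (tnth z (par i)))%:E).
  rewrite -(IHl (fun z => psi z * h j (tnth z (par j)) (tnth z j))%R)//.
  - by apply: eq_integral => z _; rewrite big_cons mulrA.
  - move=> i il; have := parl i; rewrite !inE il orbT => /(_ isT).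
    by rewrite negb_or => /andP[].
  - exact: measurable_funM.
  - by move=> z; rewrite mulr_ge0.
  - move=> z i y il; rewrite psiE ?inE ?il ?orbT// !tnth_upd_neq//.
      by apply: contraNneq jl => ->.
    by apply: contraNneq parl' => ->.
have mprod : measurable_fun setT
    (fun z : p.-tuple T => (\prod_(i <- l) H i (tnth z (par i)))%R).
  by apply: measurable_prod.
have prod0 (z : p.-tuple T) : (0 <= \prod_(i <- l) H i (tnth z (par i)))%R.
  by apply: prodr_ge0.
rewrite (integral_resample j); last 2 first.
- apply/measurable_EFinP; apply: measurable_funM => //.
  exact: measurable_funM.
- by move=> z; rewrite lee_fin !mulr_ge0.
apply: eq_integral => z _.
under eq_integral => y _.
  rewrite psiE ?mem_head// tnth_upd_same tnth_upd_neq// mulrAC EFinM.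
  have -> : (\prod_(i <- l) H i (tnth (upd z j y) (par i)) =
             \prod_(i <- l) H i (tnth z (par i)))%R.
    rewrite big_seq [RHS]big_seq; apply: eq_bigr => i il.
    rewrite tnth_upd_neq//; have := parl i; rewrite !inE il orbT => /(_ isT).
    by rewrite negb_or => /andP[].
  over.
rewrite ge0_integralZl//; last 3 first.
- apply/measurable_EFinP; apply: (@measurableT_comp _ _ _ _ _ _
    (fun z => h j z.1 z.2) _ (fun y => (tnth z (par j), y))) => //.
  exact: measurable_fun_pair.
- by move=> y _; rewrite lee_fin.
- by rewrite lee_fin mulr_ge0.
by rewrite hH -EFinM big_cons -mulrA (mulrC (\prod_(_ <- _) _)%R).
Qed.

End resampling.

(** * Regression on parents as a change of measure *)

Section shear.
Local Open Scope ereal_scope.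
Context (R : realType) (p : nat).
Variables (par : 'I_p -> 'I_p) (b s : 'I_p -> R).
Hypothesis s_gt0 : forall j, (0 < s j)%R.
Notation nu := (iid (gauss R) p).

Definition shear (l : seq 'I_p) (z : p.-tuple R) : p.-tuple R :=
  [tuple (if j \in l then affine (b j * tnth z (par j)) (s j) (tnth z j)
          else tnth z j) | j < p].

Definition leaf_ratio (j : 'I_p) (z : p.-tuple R) : R :=
  gauss_ratio (b j * tnth z (par j)) (s j) (tnth z j).

Lemma leaf_ratio_ge0 j z : (0 <= leaf_ratio j z)%R.
Proof. exact: gauss_ratio_ge0. Qed.

Lemma measurable_leaf_ratio j : measurable_fun setT (leaf_ratio j).
Proof.
apply: measurable_gauss_ratio => //; last exact: measurable_tnth.
by apply: measurable_funM => //; exact: measurable_tnth.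
Qed.

(** After resampling coordinate [j] with the others fixed, this is the one-dimensional reweighting
    [integral_gauss_ratio]. *)
Lemma integral_shear1 (j : 'I_p) (f : p.-tuple R -> \bar R) : par j != j ->
  measurable_fun setT f -> (forall z, 0 <= f z) ->
  \int[nu]_z f (upd z j (affine (b j * tnth z (par j)) (s j) (tnth z j))) =
  \int[nu]_z (f z * (leaf_ratio j z)%:E).
Proof.
move=> parj mf f0.
rewrite (integral_resample _ j)//; last first.
  apply: (measurableT_comp mf); apply: measurable_upd => //.
  apply: measurable_funD; apply: measurable_funM => //; exact: measurable_tnth.
rewrite [RHS](integral_resample _ j); last 2 first.
- apply: emeasurable_funM => //; apply/measurable_EFinP.
  exact: measurable_leaf_ratio.
- by move=> z; rewrite mule_ge0// lee_fin leaf_ratio_ge0.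
apply: eq_integral => z _.
under eq_integral do rewrite upd_upd tnth_upd_same tnth_upd_neq//.
under [RHS]eq_integral do rewrite /leaf_ratio tnth_upd_same tnth_upd_neq//.
apply: (@integral_gauss_ratio _ _ _ (fun y => f (upd z j y))) => //.
by apply: (measurableT_comp mf); exact: measurable_upd.
Qed.

Lemma integral_shear (l : seq 'I_p) (f : p.-tuple R -> \bar R) :
  uniq l -> {in l, forall i, par i \notin l} ->
  measurable_fun setT f -> (forall z, 0 <= f z) ->
  \int[nu]_z f (shear l z) =
  \int[nu]_z (f z * (\prod_(j <- l) leaf_ratio j z)%:E).
Proof.
elim: l f => [|j l IHl] f /=.
  move=> _ _ mf f0; apply: eq_integral => z _.
  by rewrite big_nil mule1; congr f; apply: eq_from_tnth => i; rewrite tnth_mktuple.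
move=> /andP[jl ul] parl mf f0.
have parjl : par j \notin j :: l by apply: parl; rewrite mem_head.
have /andP[parj parl'] : (par j != j) && (par j \notin l).
  by move: parjl; rewrite inE negb_or.
pose g z := upd z j (affine (b j * tnth z (par j)) (s j) (tnth z j)).
have mg : measurable_fun setT g.
  apply: measurable_upd => //.
  apply: measurable_funD; apply: measurable_funM => //; exact: measurable_tnth.
have mprod : measurable_fun setT (fun z => (\prod_(i <- l) leaf_ratio i z)%R).
  by apply: measurable_prod => i _; exact: measurable_leaf_ratio.
have prod0 z : (0 <= \prod_(i <- l) leaf_ratio i z)%R.
  by apply: prodr_ge0 => i _; exact: leaf_ratio_ge0.
(* Neither [j] nor its parent is moved by the shear along [l], so the simultaneous change of all
   leaves is a composition of single ones. *)
transitivity (\int[nu]_z (f \o g) (shear l z)).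
  apply: eq_integral => z _; congr f; apply: eq_from_tnth => i /=.
  rewrite tnth_upd !tnth_mktuple inE.
  by case: eqP => [->|//]; rewrite (negbTE jl) (negbTE parl').
rewrite IHl; last 4 first.
- by [].
- move=> i il; have := parl i; rewrite !inE il orbT => /(_ isT).
  by rewrite negb_or => /andP[].
- exact: measurableT_comp.
- by move=> z; exact: f0.
pose F z := f z * (\prod_(i <- l) leaf_ratio i z)%:E.
have mF : measurable_fun setT F.
  by apply: emeasurable_funM => //; exact/measurable_EFinP.
have F0 z : 0 <= F z by rewrite mule_ge0// lee_fin.
transitivity (\int[nu]_z F (g z)).
  apply: eq_integral => z _ /=; congr (_ * _%:E).
  rewrite big_seq [RHS]big_seq; apply: eq_bigr => i il.
  rewrite /leaf_ratio !tnth_upd_neq//; first by apply: contraNneq jl => <-.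
  have := parl i; rewrite !inE il orbT => /(_ isT).
  by rewrite negb_or => /andP[].
rewrite (integral_shear1 parj mF F0); apply: eq_integral => z _.
by rewrite big_cons -muleA -EFinM mulrC.
Qed.

End shear.

(** * Linear images of standard Gaussian vectors *)

Section gaussian_vector.
Context (R : realType) (p : nat).
Notation nu := (iid (gauss R) p).

(** By induction the tail of the sum is one centred normal variable, to which the first term is
    added by [integral_gauss_sum]. *)
Lemma integral_linear (n : nat) (u : 'I_n -> R) (f : R -> \bar R) :
  measurable_fun setT f -> (forall x, 0 <= f x)%E ->
  (\int[iid (gauss R) n]_z f (\sum_j u j * tnth z j)%R =
   \int[gauss R]_x f (Num.sqrt (\sum_j u j ^+ 2) * x)%R)%E.
Proof.
elim: n u f => [|n IHn] u f mf f0.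
  under eq_integral do rewrite big_ord0.
  under [in RHS]eq_integral do rewrite big_ord0 sqrtr0 mul0r.
  by rewrite [LHS]integral_probability_cst [RHS]integral_probability_cst.
rewrite integral_iidS//; last first.
  apply: (measurableT_comp mf); apply: measurable_sum => j.
  by apply: measurable_funM => //; exact: measurable_tnth.
transitivity (\int[gauss R]_x \int[gauss R]_y
    f (u ord0 * x + Num.sqrt (\sum_j u (lift ord0 j) ^+ 2) * y)%R)%E.
  apply: eq_integral => x _.
  rewrite -(IHn _ (fun y => f (u ord0 * x + y)))//; last first.
    by apply: (measurableT_comp mf); exact: measurable_funD.
  apply: eq_integral => t _; rewrite big_ord_recl tnth0.
  by under eq_bigr do rewrite tnthS.
rewrite integral_gauss_sum ?sqrtr_ge0//.
rewrite sqr_sqrtr; last by apply: sumr_ge0 => j _; exact: sqr_ge0.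
by rewrite [in RHS]big_ord_recl.
Qed.

Definition linmap (A : 'M[R]_p) (z : p.-tuple R) : p.-tuple R :=
  [tuple \sum_k A i k * tnth z k | i < p].

Lemma measurable_linmap A : measurable_fun setT (linmap A).
Proof.
apply/measurable_fun_tnthP => i.
rewrite (_ : _ \o _ = fun z => \sum_k A i k * tnth z k); last first.
  by apply/funext => z /=; rewrite tnth_mktuple.
apply: measurable_sum => j; apply: measurable_funM => //; exact: measurable_tnth.
Qed.

HB.instance Definition _ A :=
  isMeasurableFun.Build _ _ _ _ (linmap A) (measurable_linmap A).

(** Scaling a standard variable by the square root of [v] also covers [v = 0], so singular
    covariances follow the general argument. *)
Lemma normal1E (v : R) (B : set R) : measurable B -> 0 <= v ->
  normal1 v B = (\int[gauss R]_x (\1_B (Num.sqrt v * x))%:E)%E.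
Proof.
move=> mB v0; rewrite /normal1.
have m1 : measurable_fun setT (fun x : R => (\1_B x : R)%:E).
  by apply/measurable_EFinP; exact: measurable_indic.
case: eqP => [->|/eqP v1].
  under eq_integral do rewrite sqrtr0 mul0r.
  by rewrite [RHS]integral_probability_cst diracE indicE.
have sv : Num.sqrt v != 0 by rewrite sqrtr_eq0 -ltNge lt_neqAle eq_sym v1.
have m1' : (forall x : R, 0 <= (\1_B x : R)%:E)%E by move=> x; rewrite lee_fin.
under [in RHS]eq_integral do rewrite -[Num.sqrt v * _]add0r.
rewrite (integral_gauss_affine 0 sv m1 m1') (integral_normal 0 (Num.sqrt v) m1 m1').
rewrite /normal_prob integral_mkcond; apply: eq_integral => x _.
rewrite patchE indicE; case: ifPn => _; first by rewrite mul1e.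
by rewrite mul0e.
Qed.

(** The functional [u] of [A z] is the functional [u A] of [z], and the squared norm of [u A] is the
    quadratic form of [A A^T] at [u]. *)
Lemma gaussian_linmap (A : 'M[R]_p) :
  gaussian (A *m A^T) (distribution nu (linmap A)).
Proof.
move=> u B mB.
have quadE : (u *m (A *m A^T) *m u^T) 0 0 = \sum_k (u *m A) 0 k ^+ 2.
  rewrite mulmxA -mulmxA -trmx_mul mxE; apply: eq_bigr => k _.
  by rewrite [X in _ * X]mxE expr2.
rewrite quadE normal1E//; last by apply: sumr_ge0 => k _; exact: sqr_ge0.
have m1 : measurable_fun setT (fun x : R => (\1_B x : R)%:E).
  by apply/measurable_EFinP; exact: measurable_indic.
rewrite -(integral_linear (fun k => (u *m A) 0 k) m1); last first.
  by move=> x; rewrite lee_fin.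
pose g (z : p.-tuple R) := \sum_k (u *m A) 0 k * tnth z k.
have mg : measurable_fun setT g.
  apply: measurable_sum => j; apply: measurable_funM => //; exact: measurable_tnth.
have gE z : \sum_j u 0 j * tnth (linmap A z) j = g z.
  under eq_bigr do rewrite tnth_mktuple mulr_sumr.
  rewrite exchange_big; apply: eq_bigr => k _.
  by rewrite mxE mulr_suml; apply: eq_bigr => j _; rewrite mulrA.
have mgB : measurable (g @^-1` B).
  by rewrite -[X in measurable X]setTI; exact: (mg measurableT _ mB).
have DE : linmap A @^-1` [set x | B (\sum_j u 0 j * tnth x j)] = g @^-1` B.
  by apply/seteqP; split => z; rewrite /preimage/= gE.
rewrite -[LHS]/(nu (linmap A @^-1` [set x | B (\sum_j u 0 j * tnth x j)])) DE.
transitivity (\int[nu]_z (\1_(g @^-1` B) z)%:E)%E.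
  by rewrite integral_indic// setIT.
by [].
Qed.

End gaussian_vector.

(** * Testing a point against a mixture *)

Section le_cam.
Context (R : realType) (n p : nat) (r q Rad : R).
Notation nu := (iid (iid (gauss R) p) n).

Lemma gaussian_sample_linmap (A : 'M[R]_p) :
  gaussian_sample (A *m A^T) (iid (distribution (iid (gauss R) p) (linmap A)) n).
Proof.
exists (distribution (iid (gauss R) p) (linmap A)); first exact: gaussian_linmap.
by move=> B mB; exact: iid_rectangle.
Qed.

Lemma max_risk_ge (A : 'M[R]_p) (L : n.-tuple (p.-tuple R) -> R) :
  G q Rad (A *m A^T) -> measurable_fun setT L ->
  (\int[iid (distribution (iid (gauss R) p) (linmap A)) n]_t
      ((L t - ell r (A *m A^T)) ^+ 2)%:E <= max_risk r q Rad L)%E.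
Proof.
move=> GA mL; apply: ereal_sup_ubound => /=.
exists (A *m A^T), (iid (distribution (iid (gauss R) p) (linmap A)) n).
split => //; first exact: gaussian_sample_linmap.
by rewrite unlock.
Qed.

(* [S] is the sum of the [N] likelihood ratios, so that [S / N] is the density of
   the mixture. *)
Lemma le_cam_pointwise (x l0 l1 S N c : R) (tau : bool) : 0 < N -> 0 <= S ->
  2 * c * (l1 - l0) ^+ 2 * (tau%:R * S) <=
  N * (x - l0) ^+ 2 + S * (x - l1) ^+ 2 +
  (l1 - l0) ^+ 2 * c ^+ 2 * (tau%:R * (S + S ^+ 2 / N)).
Proof.
move=> N0 S0; have NS0 : 0 < N + S by lra.
case: tau => /=; last first.
  by rewrite !mul0r !mulr0 addr0 addr_ge0// mulr_ge0 ?sqr_ge0// ltW.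
rewrite !mul1r -subr_ge0.
have -> : N * (x - l0) ^+ 2 + S * (x - l1) ^+ 2 +
    (l1 - l0) ^+ 2 * c ^+ 2 * (S + S ^+ 2 / N) - 2 * c * (l1 - l0) ^+ 2 * S =
    (N * (x - l0) + S * (x - l1)) ^+ 2 / (N + S) +
    S * ((l1 - l0) * (N - c * (N + S))) ^+ 2 / (N * (N + S)).
  by field; rewrite !gt_eqF.
apply: addr_ge0; apply: divr_ge0; rewrite ?sqr_ge0 ?(ltW NS0)//.
  by rewrite mulr_ge0 ?sqr_ge0.
by rewrite mulr_ge0 ?ltW.
Qed.

Variables (A0 : 'M[R]_p) (I : finType) (A1 : I -> 'M[R]_p).
Variables (w : I -> p.-tuple R -> R) (D : set (n.-tuple (p.-tuple R))).
Variables (l1 C : R) (Q : I -> I -> R).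
Hypothesis I0 : (0 < #|I|)%N.
Hypothesis GA0 : G q Rad (A0 *m A0^T).
Hypothesis GA1 : forall a, G q Rad (A1 a *m (A1 a)^T).
Hypothesis ellA1 : forall a, ell r (A1 a *m (A1 a)^T) = l1.
Hypothesis mw : forall a, measurable_fun setT (w a).
Hypothesis w0 : forall a z, 0 <= w a z.
Hypothesis A1E : forall a (f : p.-tuple R -> \bar R), measurable_fun setT f ->
  (forall z, 0 <= f z)%E ->
  (\int[iid (gauss R) p]_z f (linmap (A1 a) z) =
   \int[iid (gauss R) p]_z (f (linmap A0 z) * (w a z)%:E))%E.
Hypothesis mD : measurable D.
Let W a (t : n.-tuple (p.-tuple R)) := \prod_(i < n) w a (tnth t i).
Hypothesis WD : forall a, ((2^-1)%:E <= \int[nu]_t (\1_D t * W a t)%:E)%E.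
Hypothesis WWD : forall a b,
  (\int[nu]_t (\1_D t * (W a t * W b t))%:E <= (Q a b)%:E)%E.
Hypothesis QC : \sum_a \sum_b Q a b <= C * #|I|%:R ^+ 2.

Let mW a : measurable_fun setT (W a).
Proof. exact: measurable_prod_tnth. Qed.

Let W0 a t : 0 <= W a t.
Proof. exact: prodr_ge0. Qed.

Let mDr : measurable_fun setT (\1_D : _ -> R).
Proof. exact: measurable_indic. Qed.

Let D0 t : 0 <= \1_D t :> R.
Proof. by rewrite indicE. Qed.

Let mapA0 (t : n.-tuple (p.-tuple R)) := [tuple of map (linmap A0) t].

Let mmapA0 : measurable_fun setT mapA0.
Proof. by apply: measurable_map_tuple; exact: measurable_linmap. Qed.

Let integral_base (F : n.-tuple (p.-tuple R) -> \bar R) :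
  measurable_fun setT F -> (forall t, 0 <= F t)%E ->
  (\int[iid (distribution (iid (gauss R) p) (linmap A0)) n]_t F t =
   \int[nu]_t F (mapA0 t))%E.
Proof.
move=> mF F0.
rewrite (@integral_iid_change _ _ _ _ _ (iid (gauss R) p) _ (linmap A0) (fun=> 1))//.
- by apply: eq_integral => t _; rewrite big1// mule1.
- move=> f mf f0; rewrite ge0_integral_distribution//.
  by apply: eq_integral => z _; rewrite mule1.
Qed.

Let integral_alt a (F : n.-tuple (p.-tuple R) -> \bar R) :
  measurable_fun setT F -> (forall t, 0 <= F t)%E ->
  (\int[iid (distribution (iid (gauss R) p) (linmap (A1 a))) n]_t F t =
   \int[nu]_t (F (mapA0 t) * (W a t)%:E))%E.
Proof.
move=> mF F0.
rewrite (@integral_iid_change _ _ _ _ _ (iid (gauss R) p) _ (linmap A0) (w a))//.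
- by move=> f mf f0; rewrite ge0_integral_distribution// -A1E.
Qed.

(** [le_cam_pointwise] is integrated with [tau] the indicator of the truncation event [D]. The
    squared errors contribute at most [2 N M], the left side is at least [K1 N / 2], and the
    correction is at most [K2 N (1 + C)]. *)
Lemma max_risk_le_cam (L : n.-tuple (p.-tuple R) -> R) : measurable_fun setT L ->
  (((l1 - ell r (A0 *m A0^T)) ^+ 2 / (8 * (1 + C)))%:E <= max_risk r q Rad L)%E.
Proof.
move=> mL; set l0 := ell r _; set M := max_risk _ _ _ _.
pose N : R := #|I|%:R; have N0 : 0 < N by rewrite ltr0n.
pose x t := L (mapA0 t).
have mx : measurable_fun setT x by exact: measurableT_comp.
pose S t := \sum_a W a t.
have mS : measurable_fun setT S by exact: measurable_sum.
have S0 t : 0 <= S t by exact: sumr_ge0.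
have sqx l : measurable_fun setT (fun t => (x t - l) ^+ 2).
  by apply: measurable_funX; exact: measurable_funB.
have risk0 : (\int[nu]_t ((x t - l0) ^+ 2)%:E <= M)%E.
  apply: le_trans (max_risk_ge GA0 mL); rewrite integral_base//.
    by apply/measurable_EFinP; apply: measurable_funX; exact: measurable_funB.
  by move=> t; rewrite lee_fin sqr_ge0.
have risk1 : (\int[nu]_t (S t * (x t - l1) ^+ 2)%:E <= N%:E * M)%E.
  have -> : (\int[nu]_t (S t * (x t - l1) ^+ 2)%:E =
      \sum_a \int[nu]_t (((x t - l1) ^+ 2)%:E * (W a t)%:E))%E.
    rewrite -ge0_integral_sum//.
    - apply: eq_integral => t _; rewrite mulr_suml -sumEFin.
      by apply: eq_bigr => a _; rewrite EFinM muleC.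
    - by move=> a; apply: emeasurable_funM; exact/measurable_EFinP.
    - by move=> a t _; rewrite mule_ge0// lee_fin ?sqr_ge0.
  have -> : (N%:E * M = \sum_(a : I) M)%E.
    by rewrite sumr_const mule_natl.
  apply: lee_sum => a _; apply: le_trans (max_risk_ge (GA1 a) mL).
  rewrite ellA1 integral_alt//.
    by apply/measurable_EFinP; apply: measurable_funX; exact: measurable_funB.
  by move=> t; rewrite lee_fin sqr_ge0.
have SD : (\int[nu]_t (\1_D t * S t)%:E =
    \sum_a \int[nu]_t (\1_D t * W a t)%:E)%E.
  rewrite -ge0_integral_sum//.
  - by apply: eq_integral => t _; rewrite mulr_sumr -sumEFin.
  - by move=> a; apply/measurable_EFinP; exact: measurable_funM.
  - by move=> a t _; rewrite lee_fin mulr_ge0.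
have SD_ge : ((N / 2)%:E <= \int[nu]_t (\1_D t * S t)%:E)%E.
  have -> : (N / 2)%:E = (\sum_(a : I) (2^-1)%:E)%E.
    by rewrite sumEFin sumr_const /N mulr_natl.
  by rewrite SD; apply: lee_sum.
(* Dropping the indicator leaves likelihood ratios, each with integral one. *)
have SD_le : (\int[nu]_t (\1_D t * S t)%:E <= N%:E)%E.
  have -> : N%:E = (\sum_(a : I) 1%:E)%E by rewrite sumEFin sumr_const.
  rewrite SD; apply: lee_sum => a _.
  rewrite [leRHS](_ : _ = \int[nu]_t (W a t)%:E)%E.
    apply: ge0_le_integral => //.
    - by move=> t _; rewrite lee_fin mulr_ge0.
    - by apply/measurable_EFinP; exact: measurable_funM.
    - exact/measurable_EFinP.
    - by move=> t _; rewrite lee_fin ler_piMl// indicE lern1 leq_b1.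
  transitivity (\int[nu]_t (1 * (W a t)%:E))%E; last first.
    by apply: eq_integral => t _; rewrite mul1e.
  by rewrite -(@integral_alt a (fun=> 1%E))// integral_probability_cst.
have SSD_le : (\int[nu]_t (\1_D t * S t ^+ 2)%:E <= (C * N ^+ 2)%:E)%E.
  have -> : (\int[nu]_t (\1_D t * S t ^+ 2)%:E =
      \sum_a \sum_b \int[nu]_t (\1_D t * (W a t * W b t))%:E)%E.
    transitivity (\sum_a \int[nu]_t
        \sum_b (\1_D t * (W a t * W b t))%:E)%E.
      rewrite -ge0_integral_sum//.
      - apply: eq_integral => t _; rewrite expr2 big_distrl/= mulr_sumr -sumEFin.
        apply: eq_bigr => a _; rewrite mulr_sumr mulr_sumr -sumEFin.
        by apply: eq_bigr.
      - move=> a; apply: emeasurable_sum => b; apply/measurable_EFinP.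
        by apply: measurable_funM => //; exact: measurable_funM.
      - by move=> a t _; apply: sume_ge0 => b _; rewrite lee_fin !mulr_ge0.
    apply: eq_bigr => a _; rewrite ge0_integral_sum//.
    - move=> b; apply/measurable_EFinP.
      by apply: measurable_funM => //; exact: measurable_funM.
    - by move=> b t _; rewrite lee_fin !mulr_ge0.
  apply: (@le_trans _ _ (\sum_a \sum_b (Q a b)%:E)%E).
    by apply: lee_sum => a _; apply: lee_sum => b _.
  under eq_bigr do rewrite sumEFin.
  by rewrite sumEFin lee_fin.
have C0 : 0 <= C.
  rewrite -(pmulr_lge0 _ (exprn_gt0 2 N0)) -lee_fin.
  by apply: le_trans SSD_le; apply: integral_ge0 => t _; rewrite lee_fin mulr_ge0 ?sqr_ge0.
(* This value maximizes [c - c ^ 2 (1 + C)], the factor of [(l1 - l0) ^ 2] in the final bound, with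
   maximum [1 / (4 (1 + C))]. *)
pose c := (2 * (1 + C))^-1; have c0 : 0 < c by rewrite invr_gt0; lra.
have msum : measurable_fun setT (fun t => S t + S t ^+ 2 / N).
  by apply: measurable_funD => //; apply: measurable_funM => //; exact: measurable_funX.
pose K1 := 2 * c * (l1 - l0) ^+ 2; pose K2 := (l1 - l0) ^+ 2 * c ^+ 2.
have K1_ge0 : 0 <= K1 by apply: mulr_ge0; rewrite ?sqr_ge0// mulr_ge0// ltW.
have K2_ge0 : 0 <= K2 by rewrite mulr_ge0 ?sqr_ge0.
have m1 : measurable_fun setT (fun t => \1_D t * S t) by exact: measurable_funM.
have m2 : measurable_fun setT (fun t => \1_D t * S t ^+ 2).
  by apply: measurable_funM => //; exact: measurable_funX.
have mS1 : measurable_fun setT (fun t => S t * (x t - l1) ^+ 2).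
  exact: measurable_funM.
have pos1 t : 0 <= \1_D t * S t by rewrite mulr_ge0.
have pos2 t : 0 <= \1_D t * S t ^+ 2 by rewrite mulr_ge0 ?sqr_ge0.
have pos3 t : 0 <= S t * (x t - l1) ^+ 2 by rewrite mulr_ge0 ?sqr_ge0.
have main : (K1%:E * \int[nu]_t (\1_D t * S t)%:E <=
    N%:E * \int[nu]_t ((x t - l0) ^+ 2)%:E +
    \int[nu]_t (S t * (x t - l1) ^+ 2)%:E +
    (K2%:E * \int[nu]_t (\1_D t * S t)%:E +
     (K2 / N)%:E * \int[nu]_t (\1_D t * S t ^+ 2)%:E))%E.
  have sq0 l t : 0 <= (x t - l) ^+ 2 by exact: sqr_ge0.
  have K2N : 0 <= K2 / N by rewrite divr_ge0// ltW.
  rewrite -(ge0_integralZl_real _ m1 pos1 K1_ge0).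
  rewrite -(ge0_integralZl_real _ (sqx l0) (sq0 l0) (ltW N0)).
  rewrite -(ge0_integralZl_real _ m1 pos1 K2_ge0).
  rewrite -(ge0_integralZl_real _ m2 pos2 K2N).
  have f1 t : 0 <= N * (x t - l0) ^+ 2 by rewrite mulr_ge0// ltW.
  have f3 t : 0 <= K2 * (\1_D t * S t) by rewrite mulr_ge0.
  have f4 t : 0 <= K2 / N * (\1_D t * S t ^+ 2) by rewrite mulr_ge0.
  have g1 : measurable_fun setT (fun t => N * (x t - l0) ^+ 2).
    exact: measurable_funM.
  have g3 : measurable_fun setT (fun t => K2 * (\1_D t * S t)).
    exact: measurable_funM.
  have g4 : measurable_fun setT (fun t => K2 / N * (\1_D t * S t ^+ 2)).
    exact: measurable_funM.
  rewrite -(ge0_integralD_real _ g1 mS1)// -(ge0_integralD_real _ g3 g4)//.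
  rewrite -ge0_integralD_real; last 4 first.
  - exact: measurable_funD.
  - exact: measurable_funD.
  - by move=> t; rewrite addr_ge0.
  - by move=> t; rewrite addr_ge0.
  apply: ge0_le_integral => //.
  - by move=> t _; rewrite lee_fin mulr_ge0.
  - by apply/measurable_EFinP; exact: measurable_funM.
  - apply/measurable_EFinP.
    by apply: measurable_funD; exact: measurable_funD.
  - move=> t _; rewrite lee_fin.
    have := le_cam_pointwise (x t) l0 l1 c (t \in D) N0 (S0 t).
    rewrite indicE /K1 /K2 => /le_trans; apply.
    by rewrite le_eqVlt; apply/orP; left; apply/eqP; field; rewrite gt_eqF.
have [eA EA] : exists eA : R, (\int[nu]_t (\1_D t * S t)%:E = eA%:E)%E.
  exists (fine (\int[nu]_t (\1_D t * S t)%:E)%E); rewrite fineK//.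
  rewrite ge0_fin_numE; first exact: le_lt_trans SD_le (ltry _).
  by apply: integral_ge0 => t _; rewrite lee_fin.
have [eB EB] : exists eB : R, (\int[nu]_t (\1_D t * S t ^+ 2)%:E = eB%:E)%E.
  exists (fine (\int[nu]_t (\1_D t * S t ^+ 2)%:E)%E); rewrite fineK//.
  rewrite ge0_fin_numE; first exact: le_lt_trans SSD_le (ltry _).
  by apply: integral_ge0 => t _; rewrite lee_fin.
have M_ge0 : (0 <= M)%E.
  by apply: le_trans risk0; apply: integral_ge0 => t _; rewrite lee_fin sqr_ge0.
move: SD_ge SD_le SSD_le main; rewrite EA EB !lee_fin -!EFinM => h1 h2 h3 main.
have : ((K1 * eA)%:E <= N%:E * M + N%:E * M + (K2 * eA + K2 / N * eB)%R%:E)%E.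
  apply: le_trans main _; rewrite EFinD; apply: leeD => //.
  by apply: leeD => //; rewrite lee_wpmul2l// lee_fin ltW.
(* An infinite maximal risk satisfies the bound trivially; otherwise only real arithmetic
   remains. *)
clearbody M; case: M M_ge0 {risk0 risk1} => [m _| |//]; last by move=> _ _; exact: leey.
rewrite -!EFinM -!EFinD !lee_fin => h4.
rewrite ler_pdivrMr; last by lra.
have h5 : K2 / N * eB <= K2 * C * N.
  have -> : K2 * C * N = K2 / N * (C * N ^+ 2) by field; rewrite gt_eqF.
  by rewrite ler_wpM2l// divr_ge0// ltW.
have h6 : K1 * (N / 2) <= K1 * eA by rewrite ler_wpM2l.
have h7 : K2 * eA <= K2 * N by rewrite ler_wpM2l.
have h8 : N * (K1 / 2 - K2 * (1 + C)) <= N * (2 * m) by nra.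
have h9 : K1 / 2 - K2 * (1 + C) <= 2 * m by rewrite ler_pM2l in h8.
have h10 : K1 / 2 - K2 * (1 + C) = (l1 - l0) ^+ 2 / (4 * (1 + C)).
  by rewrite /K1 /K2 /c; field; rewrite gt_eqF//; lra.
move: h9; rewrite h10 ler_pdivrMr; last by lra.
by nra.
Qed.

End le_cam.

(** * Covariance matrices of regressions on parent coordinates *)

Lemma sum_mulrn_eq (R : pzRingType) (I : finType) (i : I) (a : R) (F : I -> R) :
  \sum_k (a *+ (k == i)) * F k = a * F i.
Proof.
rewrite (bigD1 i)//= eqxx big1 ?addr0// => k /negbTE ->.
by rewrite mulr0n mul0r.
Qed.

Section ell_value.
Context (R : realType) (p : nat).

Lemma abs_pow0 (s : R) : abs_pow s 0 = 0.
Proof. by rewrite /abs_pow eqxx. Qed.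

Lemma abs_pow1 (s : R) : abs_pow s 1 = 1.
Proof. by rewrite /abs_pow oner_eq0 normr1 powR1. Qed.

Lemma abs_pow_gt0 (s x : R) : 0 < x -> abs_pow s x = x `^ s.
Proof. by move=> x0; rewrite /abs_pow gt_eqF// gtr0_norm. Qed.

Lemma abs_pow_ge0 (s x : R) : 0 <= abs_pow s x.
Proof. by rewrite /abs_pow; case: ifP => // _; exact: powR_ge0. Qed.

Lemma abs_pow_le (s x y : R) : 0 <= s -> 0 <= x -> x <= y ->
  abs_pow s x <= y `^ s.
Proof.
move=> s0; rewrite le_eqVlt => /predU1P[<- _|x0 xy].
  by rewrite abs_pow0 powR_ge0.
rewrite abs_pow_gt0//; apply: ge0_ler_powR; rewrite ?nnegrE ?(ltW x0)//.
exact: le_trans (ltW x0) xy.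
Qed.

Lemma ell_eq (s v : R) (Sigma : 'M[R]_p) (i0 : 'I_p) :
  (forall i, \sum_j abs_pow s (Sigma i j) <= v) ->
  \sum_j abs_pow s (Sigma i0 j) = v -> ell s Sigma = v.
Proof.
move=> le_v eq_v; apply/le_anti/andP; split.
  apply: bigmax_le => [|i _]; last exact: le_v.
  by rewrite -eq_v; apply: sumr_ge0 => j _; exact: abs_pow_ge0.
by rewrite -eq_v; apply: (le_bigmax _ _ i0).
Qed.

Lemma ell1 (s : R) : (0 < p)%N -> ell s (1%:M : 'M[R]_p) = 1.
Proof.
move=> p0.
have row1 i : \sum_j abs_pow s ((1%:M : 'M[R]_p) i j) = 1.
  rewrite (bigD1 i)//= big1; first by rewrite mxE eqxx addr0 abs_pow1.
  by move=> j /negbTE ji; rewrite mxE eq_sym ji abs_pow0.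
by apply: (@ell_eq _ _ _ (Ordinal p0)) => // i; rewrite row1.
Qed.

End ell_value.

Section leaf_covariance.
Context (R : realType) (p : nat).
Variables (par : 'I_p -> 'I_p) (b : 'I_p -> R).

(** The regression is written on the innovation of the parent, which is the parent itself when
    [b (par i) = 0]. A root may be its own parent: with coefficient 0 its row is that of the
    identity. *)
Definition leaf_mx : 'M[R]_p :=
  \matrix_(i, k) (b i *+ (k == par i) + Num.sqrt (1 - b i ^+ 2) *+ (k == i)).

Definition leaf_cov : 'M[R]_p := leaf_mx *m leaf_mx^T.

Lemma tnth_linmap_leaf_mx (z : p.-tuple R) i : tnth (linmap leaf_mx z) i =
  affine (b i * tnth z (par i)) (Num.sqrt (1 - b i ^+ 2)) (tnth z i).
Proof.
rewrite tnth_mktuple; under eq_bigr do rewrite mxE mulrDl.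
by rewrite big_split/= !sum_mulrn_eq.
Qed.

Hypothesis b_par : forall i, b (par i) = 0.
Hypothesis b_ge0 : forall i, 0 <= b i.
Hypothesis b_le1 : forall i, b i <= 1.

(** Off the diagonal, the three terms account for siblings, [j] the parent of [i], and [i] the
    parent of [j]. The innovation of a parent has coefficient one because parents are not
    regressed. *)
Lemma leaf_covE i j : leaf_cov i j = if i == j then 1 else
  b i * b j *+ (par i == par j) + b i *+ (par i == j) + b j *+ (par j == i).
Proof.
rewrite mxE; under eq_bigr do rewrite [X in X * _]mxE mulrDl.
rewrite big_split/= !sum_mulrn_eq !mxE.
have sqrt1 k : Num.sqrt (1 - b (par k) ^+ 2) = 1.
  by rewrite b_par expr0n/= subr0 sqrtr1.
have [<-|neq] := eqVneq i j.
  rewrite !eqxx (eq_sym i) !mulr1n; case: eqP => [pari|_].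
    by have := b_par i; rewrite pari => ->; rewrite expr0n/= subr0 sqrtr1; ring.
  rewrite !mulr0n addr0 add0r -!expr2 sqr_sqrtr; first by ring.
  by rewrite subr_ge0 expr_le1.
rewrite (eq_sym i (par j)) mulr0n addr0 mulrDr mulrnAr.
have -> : b i * (Num.sqrt (1 - b j ^+ 2) *+ (par i == j)) = b i *+ (par i == j).
  by case: eqP => [<-|_]; rewrite ?sqrt1 ?mulr1n ?mulr1// !mulr0n mulr0.
have -> : Num.sqrt (1 - b i ^+ 2) * (b j *+ (par j == i)) = b j *+ (par j == i).
  by case: eqP => [<-|_]; rewrite ?sqrt1 ?mulr1n ?mul1r// !mulr0n mulr0.
by [].
Qed.

Lemma psd_mulmx_tr m (A : 'M[R]_m) : psd (A *m A^T).
Proof.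
split=> [|u]; first by rewrite trmx_mul trmxK.
rewrite mulmxA -mulmxA -trmx_mul mxE; apply: sumr_ge0 => k _.
by rewrite [X in _ * X]mxE -expr2 sqr_ge0.
Qed.

Lemma leaf_cov_in_G q Rad : ell q leaf_cov <= Rad -> G q Rad leaf_cov.
Proof.
move=> le_Rad; split => //; first exact: psd_mulmx_tr.
apply/matrixP => i j; rewrite [LHS]mxE [X in X *+ _]mxE leaf_covE eqxx.
by rewrite mxE.
Qed.

Lemma leaf_row s i : \sum_j abs_pow s (leaf_cov i j) =
  1 + \sum_(j | j != i) abs_pow s
    (b i * b j *+ (par i == par j) + b i *+ (par i == j) + b j *+ (par j == i)).
Proof.
rewrite (bigD1 i)//= leaf_covE eqxx abs_pow1; congr (_ + _).
by apply: eq_bigr => j /negbTE ji; rewrite leaf_covE eq_sym ji.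
Qed.

Lemma ell_matching (s : R) (i0 : 'I_p) : 0 <= s -> 0 < b i0 ->
  (forall i, b i <= b i0) ->
  (forall i j, b i != 0 -> b j != 0 -> par i = par j -> i = j) ->
  ell s leaf_cov = 1 + b i0 `^ s.
Proof.
move=> s0 bi0 b_le inj.
have leaf i j : j != i -> b i * b j *+ (par i == par j) +
    b i *+ (par i == j) + b j *+ (par j == i) =
    b i *+ (par i == j) + b j *+ (par j == i).
  move=> ji; case: eqP => [pp|_]; last by rewrite mulr0n add0r.
  have [->|bi] := eqVneq (b i) 0; first by rewrite mul0r mul0rn add0r.
  have [->|bj] := eqVneq (b j) 0; first by rewrite mulr0 mul0rn add0r.
  by rewrite (inj _ _ bi bj pp) eqxx in ji.
have rowE i : b i != 0 -> \sum_j abs_pow s (leaf_cov i j) = 1 + abs_pow s (b i).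
  move=> bi; rewrite leaf_row (bigD1 (par i))/=; last first.
    by apply: contraNneq bi => <-; rewrite b_par.
  rewrite leaf; last by apply: contraNneq bi => <-; rewrite b_par.
  rewrite eqxx b_par mul0rn addr0 big1 ?addr0// => j /andP[ji /negbTE jp].
  rewrite leaf// (eq_sym _ j) jp mulr0n add0r; case: eqP => [pj|_].
    by rewrite -pj b_par eqxx in bi.
  by rewrite mulr0n abs_pow0.
apply: (@ell_eq _ _ _ _ _ i0); last by rewrite rowE ?gt_eqF// abs_pow_gt0.
move=> i; have [bi|bi] := eqVneq (b i) 0; last by rewrite rowE// lerD2l abs_pow_le.
rewrite leaf_row lerD2l.
(* A root is correlated either with its unique active leaf or with no coordinate. *)
have [[j0 bj0 pj0]|none] := pselect (exists2 j, b j != 0 & par j = i).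
  have j0i : j0 != i by apply: contraNneq bj0 => ->; rewrite bi.
  rewrite (bigD1 j0)//= big1; last first.
    move=> j /andP[ji jj0]; rewrite leaf// bi mul0rn add0r.
    case: eqP => [pj|_]; last by rewrite mulr0n abs_pow0.
    have [->|bj] := eqVneq (b j) 0; first by rewrite mul0rn abs_pow0.
    by rewrite (inj _ _ bj bj0 _) ?eqxx ?pj ?pj0// in jj0.
  by rewrite addr0 leaf// pj0 eqxx bi mul0rn add0r mulr1n abs_pow_le.
rewrite big1 ?powR_ge0// => j ji; rewrite leaf// bi mul0rn add0r.
case: eqP => [pj|_]; last by rewrite mulr0n abs_pow0.
have [->|bj] := eqVneq (b j) 0; first by rewrite mul0rn abs_pow0.
by case: none; exists j.
Qed.

End leaf_covariance.

(** * The covariance of a star *)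

Section star.
Context (R : realType) (p : nat) (i0 : 'I_p) (A : {set 'I_p}) (dl : R).
Hypotheses (i0A : i0 \notin A) (dl_gt0 : 0 < dl) (dl_le1 : dl <= 1).

Definition star_coef (i : 'I_p) : R := if i \in A then dl else 0.

Lemma star_coef_center : star_coef i0 = 0.
Proof. by rewrite /star_coef (negbTE i0A). Qed.

Lemma star_coef_ge0 i : 0 <= star_coef i.
Proof. by rewrite /star_coef; case: ifP => // _; exact: ltW. Qed.

Lemma star_coef_le1 i : star_coef i <= 1.
Proof. by rewrite /star_coef; case: ifP. Qed.

(** The row of the centre attains the maximum: a leaf has correlation [dl] with the centre and
    [dl ^ 2 <= dl] with the other leaves, hence as many nonzero entries and none larger. *)
Lemma ell_star (s : R) : 0 <= s ->
  ell s (leaf_cov (fun=> i0) star_coef) = 1 + #|A|%:R * dl `^ s.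
Proof.
move=> s0.
have row := @leaf_row R p (fun=> i0) _ (fun=> star_coef_center)
  star_coef_ge0 star_coef_le1 s.
have row0 : \sum_j abs_pow s (leaf_cov (fun=> i0) star_coef i0 j) =
    1 + #|A|%:R * dl `^ s.
  rewrite row; congr (_ + _).
  transitivity (\sum_(j in A) dl `^ s); last first.
    by rewrite sumr_const mulr_natl.
  rewrite [LHS]big_mkcond [RHS]big_mkcond; apply: eq_bigr => j _.
  rewrite star_coef_center mul0r mul0rn add0r mul0rn add0r eqxx mulr1n /star_coef.
  have [->|] := eqVneq j i0; first by rewrite (negbTE i0A).
  by move=> _ /=; case: (j \in A); rewrite ?abs_pow0 ?abs_pow_gt0.
apply: (ell_eq _ row0) => i.
have [->|ii0] := eqVneq i i0; first by rewrite row0.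
rewrite row lerD2l; have [iA|iA] := boolP (i \in A); last first.
  rewrite big1 ?mulr_ge0 ?powR_ge0// => j ji.
  rewrite {1 3}/star_coef (negbTE iA) mul0r !mul0rn !add0r (eq_sym i0 i) (negbTE ii0).
  by rewrite mulr0n abs_pow0.
(* The coordinates correlated with a leaf [i] are obtained from [A] by exchanging [i] for the
   centre. *)
have cardA : #|(i0 |: A) :\ i| = #|A|.
  by have := cardsD1 i (i0 |: A); rewrite cardsU1 i0A !inE iA orbT => -[].
rewrite -cardA mulr_natl -sumr_const.
rewrite [leLHS]big_mkcond [leRHS]big_mkcond; apply: ler_sum => j _.
rewrite !inE; case: (j != i) => //=.
rewrite eqxx mulr1n (eq_sym i0 i) (negbTE ii0) mulr0n addr0 {1 3}/star_coef iA.
have [->|ji0] := eqVneq j i0.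
  by rewrite star_coef_center mulr0 add0r ?eqxx mulr1n abs_pow_le// ltW.
rewrite ?(eq_sym i0) ?(negbTE ji0) mulr0n addr0 /star_coef.
case: ifP => _ /=; last by rewrite mulr0 abs_pow0.
by apply: abs_pow_le; rewrite ?mulr_ge0 ?ler_piMl ?(ltW dl_gt0).
Qed.

End star.

(** * Stars with unknown leaves *)

Section star_design.
Context (R : realType) (p k m : nat).
Hypotheses (m0 : (0 < m)%N) (kmp : (k * m < p)%N).

(* Coordinate 0 is the centre and block [b] occupies the coordinates from
   [b * m + 1] to [b * m + m]. *)
Lemma block_pos_lt (b : 'I_k) (e : 'I_m) : ((b * m + e).+1 < p)%N.
Proof.
apply: leq_trans kmp; rewrite ltnS -addnS.
apply: (@leq_trans (b * m + m)); first by rewrite leq_add2l.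
by rewrite -mulSnr leq_mul2r ltn_ord orbT.
Qed.

Definition block_pos b e : 'I_p := Ordinal (block_pos_lt b e).

Definition block_center : 'I_p := Ordinal (leq_ltn_trans (leq0n (k * m)) kmp).

Lemma block_pos_inj b e b' e' : block_pos b e = block_pos b' e' ->
  b = b' /\ e = e'.
Proof.
case=> eq_pos; split; apply: val_inj => /=.
  have := congr1 (divn^~ m) eq_pos.
  by rewrite /= !divnMDl// !divn_small// !addn0.
have := congr1 (modn^~ m) eq_pos.
by rewrite /= !modnMDl !modn_small.
Qed.

Definition star_leaves (f : {ffun 'I_k -> 'I_m}) : {set 'I_p} :=
  [set block_pos b (f b) | b : 'I_k].

Lemma block_center_notin f : block_center \notin star_leaves f.
Proof. by apply/imsetP => -[b _ /(congr1 val)]. Qed.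

Lemma mem_star_leaves f b e : (block_pos b e \in star_leaves f) = (e == f b).
Proof.
apply/imsetP/eqP => [[b' _ /block_pos_inj[-> ->]]//|->]; by exists b.
Qed.

Lemma card_star_leaves f : #|star_leaves f| = k.
Proof. by rewrite card_imset ?card_ord// => b b' /block_pos_inj[]. Qed.

Definition agree (f g : {ffun 'I_k -> 'I_m}) := #|[pred b | f b == g b]|.

Lemma card_star_leavesI f g : #|star_leaves f :&: star_leaves g| = agree f g.
Proof.
rewrite -[RHS](@card_imset _ _ (fun b => block_pos b (f b))); last first.
  by move=> b b' /block_pos_inj[].
apply: eq_card => j; rewrite inE; apply/andP/imsetP => [[]|[b]].
  move=> /imsetP[b _ ->]; rewrite mem_star_leaves => fg.
  by exists b; rewrite ?inE.
by rewrite inE => fg ->; rewrite !mem_star_leaves eqxx fg.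
Qed.

(** For fixed [f] the sum over [g] factors over the blocks; in each block one choice agrees and
    contributes [x], and the other [m - 1] contribute 1. *)
Lemma sum_agree (x : R) :
  \sum_(f : {ffun 'I_k -> 'I_m}) \sum_(g : {ffun 'I_k -> 'I_m}) x ^+ agree f g =
  m%:R ^+ k * (x + m%:R - 1) ^+ k.
Proof.
transitivity (\sum_(f : {ffun 'I_k -> 'I_m}) (x + m%:R - 1) ^+ k); last first.
  by rewrite sumr_const card_ffun !card_ord -[in RHS]natrX mulr_natl.
apply: eq_bigr => f _.
transitivity (\prod_(b < k) \sum_(e < m) (if f b == e then x else 1)).
  rewrite (bigA_distr_bigA (fun b e => if f b == e then x else 1)).
  apply: eq_bigr => g _; rewrite -big_mkcond prodr_const /agree.
  by congr (_ ^+ _); apply: eq_card => b; rewrite !inE.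
rewrite -[in RHS](card_ord k) -prodr_const; apply: eq_bigr => b _.
rewrite (bigD1 (f b))//= eqxx.
under eq_bigr => e /negbTE ef do rewrite eq_sym ef.
rewrite sumr_const -addrA; congr (_ + _).
have -> : #|[pred e | e != f b]| = m.-1.
  by have := cardC1 (f b); rewrite card_ord => <-; apply: eq_card => e; rewrite !inE.
by rewrite -subn1 natrB.
Qed.

End star_design.

(** * Moments of the likelihood ratio of a star *)

Section star_moments.
Context (R : realType) (p : nat) (i0 : 'I_p) (dl : R).
Hypotheses (dl_gt0 : 0 < dl) (dl_le : dl <= 2^-1).
Notation nu := (iid (gauss R) p).

Definition star_sd : R := Num.sqrt (1 - dl ^+ 2).

Let dl2_le : dl ^+ 2 <= 4^-1.
Proof.
by rewrite expr2; apply: le_trans (ler_pM _ _ dl_le dl_le) _; rewrite ?(ltW dl_gt0)//; lra.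
Qed.

Lemma star_sd_gt0 : 0 < star_sd.
Proof. by rewrite sqrtr_gt0; have := dl2_le; lra. Qed.

Definition star_ratio (j : 'I_p) (z : p.-tuple R) : R :=
  leaf_ratio (fun=> i0) (fun=> dl) (fun=> star_sd) j z.

(** The second moment of the likelihood ratio of one leaf, conditionally on the value [x] of the
    centre. *)
Definition star_chi (x : R) : R :=
  expR ((dl * x) ^+ 2 / (2 - star_sd ^+ 2)) /
  (star_sd * Num.sqrt (2 - star_sd ^+ 2)).

(** Given the centre the leaves are independent; exponents 0 and 1 integrate to one, and exponent 2
    to [star_chi]. The exponents cover both a single star and the product of two. *)
Lemma star_row (e : 'I_p -> nat) (psi : R -> R) :
  e i0 = 0%N -> (forall j, (e j <= 2)%N) ->
  measurable_fun setT psi -> (forall x, 0 <= psi x) ->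
  (\int[nu]_z (psi (tnth z i0) * \prod_j star_ratio j z ^+ e j)%:E =
   \int[gauss R]_x (psi x * star_chi x ^+ #|[pred j | e j == 2]|)%:E)%E.
Proof.
move=> e0 e2 mpsi psi0.
have sd0 := star_sd_gt0.
have sd2 : star_sd ^+ 2 < 2.
  by rewrite sqr_sqrtr; have := sqr_ge0 dl; have := dl2_le; lra.
pose h j x y := gauss_ratio (dl * x) star_sd y ^+ e j.
pose H j x := if e j == 2 then star_chi x else 1.
have chi0 x : 0 <= star_chi x.
  by rewrite divr_ge0 ?expR_ge0// mulr_ge0 ?sqrtr_ge0// ltW.
have mchi : measurable_fun setT star_chi.
  apply: measurable_funM => //; apply: measurableT_comp => //.
  apply: measurable_funM => //; apply: measurable_funX; exact: measurable_funM.
pose l := enum (predC1 i0).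
have lP j : (j \in l) = (j != i0) by rewrite mem_enum !inE.
transitivity (\int[nu]_z (psi (tnth z i0) *
    \prod_(j <- l) h j (tnth z i0) (tnth z j))%:E)%E.
  apply: eq_integral => z _; congr (_ * _)%:E.
  rewrite (bigD1 i0)//= e0 expr0 mul1r /l big_enum/=.
  by apply: eq_big => // j; rewrite !inE.
rewrite (@integral_iid_out _ _ _ _ _ l (fun=> i0) (fun z => psi (tnth z i0)) h H).
- transitivity (\int[nu]_z (fun x => (psi x * \prod_(j <- l) H j x)%:E) (tnth z i0))%E.
    by [].
  rewrite (@integral_iid_coord _ _ _ (gauss R) p i0 (fun x => (psi x * \prod_(j <- l) H j x)%:E)).
  + apply: eq_integral => x _; congr (_ * _)%:E.
    rewrite /l big_enum /H -big_mkcondr prodr_const; congr (_ ^+ _).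
    apply: eq_card => j; transitivity ((j != i0) && (e j == 2)) => //.
    by rewrite inE; have [->|] := eqVneq j i0; rewrite ?e0.
  + apply/measurable_EFinP; apply: measurable_funM => //.
    by apply: measurable_prod => j _; rewrite /H; case: (e j == 2).
  + move=> x; rewrite lee_fin mulr_ge0// prodr_ge0// => j _.
    by rewrite /H; case: (e j == 2).
- exact: enum_uniq.
- by move=> j _; rewrite lP eqxx.
- by apply: (measurableT_comp mpsi); exact: measurable_tnth.
- by move=> z; exact: psi0.
- by move=> z j y; rewrite lP => ji; rewrite tnth_upd_neq// eq_sym.
- move=> j; apply: measurable_funX; apply: measurable_gauss_ratio => //.
  exact: measurable_funM.
- by move=> j x y; rewrite exprn_ge0// gauss_ratio_ge0.
- by move=> j; rewrite /H; case: (e j == 2).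
- by move=> j x; rewrite /H; case: (e j == 2).
move=> j x; rewrite /h /H; have := e2 j; case: (e j) => [|[|[|//]]] _ /=.
- exact: (integral_probability_cst (gauss R) 1%E).
- exact: integral_gauss_ratio1.
- exact: integral_gauss_ratio_sqr.
Qed.

End star_moments.

Lemma linmap1 (R : realType) (p : nat) (z : p.-tuple R) : linmap 1%:M z = z.
Proof.
apply: eq_from_tnth => i; rewrite tnth_mktuple (bigD1 i)//= big1.
  by rewrite mxE eqxx mul1r addr0.
by move=> k /negbTE ki; rewrite mxE eq_sym ki mul0r.
Qed.

(** Through [1 + y], since [(1 + y) ^ 2 (1 - y) - 1 = y (1 - y - y ^ 2)] is nonnegative in this
    range. *)
Lemma inv_sqrt_le_expR (R : realType) (y : R) : 0 <= y -> y <= 2^-1 ->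
  (Num.sqrt (1 - y))^-1 <= expR y.
Proof.
move=> y0 y1; have y2 : y ^+ 2 <= 2^-1 * y by rewrite expr2 ler_wpM2r.
have q0 : 0 < 1 - y by lra.
have S0 : 0 < Num.sqrt (1 - y) by rewrite sqrtr_gt0.
rewrite -div1r ler_pdivrMr//.
apply: (@le_trans _ _ ((1 + y) * Num.sqrt (1 - y))); last first.
  by rewrite ler_wpM2r ?expR_ge1Dx// ltW.
rewrite -(@expr_ge1 _ 2)//; last by rewrite mulr_ge0 ?ltW// ltr_wpDr.
rewrite exprMn sqr_sqrtr ?(ltW q0)// -subr_ge0.
have -> : (1 + y) ^+ 2 * (1 - y) - 1 = y * (1 - y - y ^+ 2) by ring.
by apply: mulr_ge0 => //; lra.
Qed.

Section star_bound.
Context (R : realType) (n p k m : nat) (r q Rad dl : R).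
Hypotheses (n0 : (0 < n)%N) (m0 : (0 < m)%N) (kmp : (k * m < p)%N).
Hypotheses (r0 : 0 < r) (q0 : 0 <= q) (dl_gt0 : 0 < dl) (dl_le : dl <= 2^-1).
Hypothesis star_le : 1 + k%:R * dl `^ q <= Rad.
Hypothesis chi_le : k%:R * (expR (9 * n%:R * dl ^+ 2) - 1) <= 2 * m%:R.
Notation nu := (iid (gauss R) p).
Notation I := {ffun 'I_k -> 'I_m}.
Notation i0 := (block_center kmp).
Notation A := (star_leaves kmp).

Let mult (f : I) (j : 'I_p) : nat := j \in A f.

Let w (f : I) (z : p.-tuple R) : R :=
  \prod_j star_ratio i0 dl j z ^+ mult f j.

Let th : R := dl ^+ 2 / (1 + dl ^+ 2).
Let K : R := (star_sd dl * Num.sqrt (1 + dl ^+ 2))^-1.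

Let dl2_le : dl ^+ 2 <= 4^-1.
Proof.
by rewrite expr2; apply: le_trans (ler_pM _ _ dl_le dl_le) _;
  rewrite ?(ltW dl_gt0)//; lra.
Qed.

Let dl2_ge0 : 0 <= dl ^+ 2. Proof. exact: sqr_ge0. Qed.

Let sdE : star_sd dl ^+ 2 = 1 - dl ^+ 2.
Proof. by rewrite sqr_sqrtr//; have := dl2_le; lra. Qed.

Let chiE x : star_chi dl x = expR (th * x ^+ 2) * K.
Proof.
rewrite /star_chi sdE (_ : 2 - (1 - dl ^+ 2) = 1 + dl ^+ 2); last by ring.
by congr (expR _ * _); rewrite /th exprMn mulrAC.
Qed.

Let th_ge0 : 0 <= th.
Proof. by rewrite divr_ge0// addr_ge0. Qed.

Let th_le : th <= dl ^+ 2.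
Proof.
rewrite ler_pdivrMr; last by have := dl2_ge0; lra.
by rewrite ler_peMr// lerDl.
Qed.

Let K_gt0 : 0 < K.
Proof.
by rewrite invr_gt0 mulr_gt0 ?star_sd_gt0// sqrtr_gt0; have := dl2_ge0; lra.
Qed.

Let K_le : K <= expR (dl ^+ 2).
Proof.
rewrite /K /star_sd -sqrtrM; last by have := dl2_le; lra.
rewrite (_ : (1 - dl ^+ 2) * (1 + dl ^+ 2) = 1 - (dl ^+ 2) ^+ 2); last by ring.
have := dl2_ge0; have := dl2_le; set x := dl ^+ 2 => x1 x0.
have x2 : x ^+ 2 <= 4^-1 * x by rewrite expr2 ler_wpM2r.
apply: (le_trans (inv_sqrt_le_expR _ _)); rewrite ?sqr_ge0 ?ler_expR//; lra.
Qed.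

Let mult_center f : mult f i0 = 0%N.
Proof. by rewrite /mult (negbTE (block_center_notin _ _)). Qed.

Let mw f : measurable_fun setT (w f).
Proof.
apply: measurable_prod => j _; apply: measurable_funX.
by apply: measurable_leaf_ratio => _; exact: star_sd_gt0.
Qed.

Let w0 f z : 0 <= w f z.
Proof. by apply: prodr_ge0 => j _; rewrite exprn_ge0// leaf_ratio_ge0. Qed.

Let integral_w f (psi : R -> R) : measurable_fun setT psi ->
  (forall x, 0 <= psi x) ->
  (\int[nu]_z (psi (tnth z i0) * w f z)%:E = \int[gauss R]_x (psi x)%:E)%E.
Proof.
move=> mpsi psi0; rewrite star_row//; last by move=> j; rewrite /mult; case: (j \in A f).
apply: eq_integral => x _; rewrite (_ : #|_| = 0%N) ?mulr1//.
by apply: eq_card0 => j; rewrite !inE /mult; case: (j \in A f).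
Qed.

(** By [chiE] each common leaf contributes [K] times the exponential of [th x ^ 2] in the value [x]
    of the centre; the prefactor cancels these exponentials and leaves a constant. *)
Let integral_ww f g : let s := (agree f g)%:R in
  (\int[nu]_z (expR (- (s * th) * tnth z i0 ^+ 2) * (w f z * w g z))%:E =
   (K ^+ agree f g)%:E)%E.
Proof.
move=> s.
transitivity (\int[nu]_z (expR (- (s * th) * tnth z i0 ^+ 2) *
    \prod_j star_ratio i0 dl j z ^+ (mult f j + mult g j))%:E)%E.
  apply: eq_integral => z _; congr (_ * _)%:E; rewrite -big_split/=.
  by apply: eq_bigr => j _; rewrite exprD.
rewrite (@star_row _ _ i0 dl dl_gt0 dl_le (fun j => mult f j + mult g j)%N
  (fun x => expR (- (s * th) * x ^+ 2))); last 4 first.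
- by rewrite !mult_center.
- move=> j; rewrite /mult; by case: (j \in A f); case: (j \in A g).
- by apply: measurableT_comp => //; exact: measurable_funM.
- by move=> x; exact: expR_ge0.
have -> : #|[pred j | (mult f j + mult g j)%N == 2]| = agree f g.
  rewrite -(card_star_leavesI m0 kmp); apply: eq_card => j.
  by rewrite !inE /mult; case: (j \in A f); case: (j \in A g).
transitivity (\int[gauss R]_x (K ^+ agree f g)%:E)%E; last first.
  exact: (integral_probability_cst (gauss R)).
apply: eq_integral => x _; congr EFin.
rewrite chiE exprMn mulrA -expRM_natl -expRD /s.
by rewrite mulNr mulrA addNr expR0 mul1r.
Qed.

Let alt f (h : p.-tuple R -> \bar R) : measurable_fun setT h ->
  (forall z, 0 <= h z)%E ->
  (\int[nu]_z h (linmap (leaf_mx (fun=> i0) (star_coef (A f) dl)) z) =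
   \int[nu]_z (h (linmap 1%:M z) * (w f z)%:E))%E.
Proof.
move=> mh h0.
have sd0 (j : 'I_p) : 0 < star_sd dl by exact: star_sd_gt0.
transitivity (\int[nu]_z (h z * (w f z)%:E))%E; last first.
  by under [RHS]eq_integral do rewrite linmap1.
transitivity (\int[nu]_z h (shear (fun=> i0) (fun=> dl) (fun=> star_sd dl)
    (enum (A f)) z))%E.
  apply: eq_integral => z _; congr h; apply: eq_from_tnth => j.
  rewrite tnth_linmap_leaf_mx [RHS]tnth_mktuple mem_enum /star_coef.
  case: (j \in A f) => //.
  by rewrite expr0n/= subr0 sqrtr1 mul0r /affine add0r mul1r.
rewrite (@integral_shear _ _ (fun=> i0) (fun=> dl) (fun=> star_sd dl) sd0)//; last 2 first.
- exact: enum_uniq.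
- by move=> j _; rewrite mem_enum block_center_notin.
apply: eq_integral => z _; congr (_ * _%:E)%E.
rewrite big_enum big_mkcond; apply: eq_bigr => j _ /=.
by rewrite /mult; case: (j \in A f).
Qed.

Let D : set (n.-tuple (p.-tuple R)) :=
  [set t | \sum_(i < n) tnth (tnth t i) i0 ^+ 2 <= 8 * n%:R].

Let mcoord (i : 'I_n) : measurable_fun setT
  (fun t : n.-tuple (p.-tuple R) => tnth (tnth t i) i0).
Proof.
apply: (@measurableT_comp _ _ _ _ _ _ (fun z : p.-tuple R => tnth z i0)).
  exact: measurable_tnth.
exact: measurable_tnth.
Qed.

Let mD : measurable D.
Proof.
pose g (t : n.-tuple (p.-tuple R)) := \sum_(i < n) tnth (tnth t i) i0 ^+ 2.
have mg : measurable_fun setT g.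
  by apply: measurable_sum => i; apply: measurable_funX; exact: mcoord.
rewrite (_ : D = setT `&` g @^-1` `]-oo, 8 * n%:R]).
  exact: (mg measurableT).
by apply/seteqP; split => t; rewrite /D /g /= in_itv/=; [|case].
Qed.

(* Bounding the indicator by an exponential keeps the second moment a product over
   the sample, and [la] is chosen to cancel the growth of the conditional second
   moment in the value of the centre. *)
Let le_1D (la : R) t : 0 <= la ->
  \1_D t <= expR (8 * n%:R * la) *
    \prod_(i < n) expR (- la * tnth (tnth t i) i0 ^+ 2).
Proof.
move=> la0; rewrite -expR_sum -expRD -mulr_sumr indicE.
have [/set_mem Dt|_] := boolP (t \in D); last exact: expR_ge0.
rewrite mulNr mulrC -mulrBr -[leLHS]expR0 ler_expR mulr_ge0//.
by rewrite subr_ge0.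
Qed.

(** A Chernoff bound for the complement of [D], with parameter [1 / 4]: there the total exponent is
    positive because [8 / 4 = 2]. *)
Let ge_1D t : 1 <= \1_D t +
  \prod_(i < n) expR (4^-1 * tnth (tnth t i) i0 ^+ 2 - 2) :> R.
Proof.
rewrite -expR_sum sumrB -mulr_sumr sumr_const card_ord indicE.
have [_|/negP tD] := boolP (t \in D); first by rewrite lerDl expR_ge0.
rewrite add0r -[leLHS]expR0 ler_expR subr_ge0 -mulr_natr.
have : 8 * n%:R < \sum_(i < n) tnth (tnth t i) i0 ^+ 2.
  by rewrite ltNge; apply/negP => Dt; apply: tD; exact/mem_set.
by lra.
Qed.

Lemma star_bound (L : n.-tuple (p.-tuple R) -> R) : measurable_fun setT L ->
  (((k%:R * dl `^ r) ^+ 2 / (8 * (1 + expR 2)))%:E <= max_risk r q Rad L)%E.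
Proof.
move=> mL.
have p0 : (0 < p)%N by apply: leq_ltn_trans kmp.
have dl_le1 : dl <= 1 by apply: le_trans dl_le _; lra.
have one_mx : (1%:M : 'M[R]_p) *m 1%:M^T = 1%:M by rewrite trmx1 mulmx1.
have Rad1 : 1 <= Rad.
  by apply: le_trans star_le; rewrite lerDl mulr_ge0// powR_ge0.
have I0 : (0 < #|{: I}|)%N by rewrite card_ffun !card_ord expn_gt0 m0.
have coefE f s : 0 <= s -> ell s (leaf_cov (fun=> i0) (star_coef (A f) dl)) =
    1 + k%:R * dl `^ s.
  move=> s0; rewrite ell_star// ?block_center_notin//.
  by rewrite card_star_leaves.
have mW f : measurable_fun setT
    (fun t : n.-tuple (p.-tuple R) => \prod_(i < n) w f (tnth t i)).
  exact: measurable_prod_tnth.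
have W0 f (t : n.-tuple (p.-tuple R)) : 0 <= \prod_(i < n) w f (tnth t i).
  exact: prodr_ge0.
have m1D : measurable_fun setT (\1_D : _ -> R) by exact: measurable_indic.
(* The factor contributed by one common leaf to the truncated second moment: 8 comes from the
   threshold in [D], and 1 from [K <= expR (dl ^ 2)]. *)
set Gb := expR (9 * n%:R * dl ^+ 2).
have := @max_risk_le_cam R n p r q Rad 1%:M _
  (fun f : I => leaf_mx (fun=> i0) (star_coef (A f) dl)) w D
  (1 + k%:R * dl `^ r) (expR 2) (fun f g => Gb ^+ agree f g) I0.
rewrite one_mx ell1// addrAC subrr add0r; apply => //.
- split; [|by rewrite ell1|].
    by rewrite -one_mx; exact: psd_mulmx_tr.
  by apply/matrixP => i j; rewrite !mxE eqxx.
- move=> f; apply: leaf_cov_in_G.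
  + by move=> _; rewrite star_coef_center// block_center_notin.
  + exact: star_coef_ge0.
  + exact: star_coef_le1.
  + by rewrite coefE.
- by move=> f; rewrite coefE// ltW.
- move=> f; set X := (\int[_]_t _)%E.
  pose c : R := expR (- 2) * (Num.sqrt (1 - 2 * 4^-1))^-1.
  have c_ge0 : 0 <= c by rewrite mulr_ge0 ?expR_ge0// invr_ge0 sqrtr_ge0.
  (* The constant [c] is the Chernoff factor of one observation; its inverse is at least
     [3 * (2 / 3) = 2]. *)
  have c_le : c <= 2^-1.
    rewrite /c expRN -invfM lef_pV2 ?posrE//; last first.
      by rewrite mulr_gt0 ?expR_gt0// sqrtr_gt0; lra.
    have e2 : 3 <= expR 2 :> R by apply: le_trans _ (expR_ge1Dx 2); lra.
    have s2 : 2 / 3 <= Num.sqrt (1 - 2 * 4^-1) :> R.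
      have h23 : 0 <= 2 / 3 :> R by lra.
      rewrite -(@ler_pXn2r _ 2) ?nnegrE ?sqrtr_ge0//.
      by rewrite sqr_sqrtr; [rewrite expr2; lra|lra].
    apply: (@le_trans _ _ (3 * (2 / 3))); first by lra.
    by apply: ler_pM => //; lra.
  have cn_le : c ^+ n <= 2^-1.
    apply: (le_trans _ c_le); rewrite -[leRHS]expr1 ler_wiXn2l//.
    by apply: (le_trans c_le); lra.
  pose tail (x : R) := expR (4^-1 * x ^+ 2 - 2).
  have mtail : measurable_fun setT tail.
    apply: measurableT_comp => //; apply: measurable_funB => //.
    exact: measurable_funM.
  have tail0 x : 0 <= tail x by exact: expR_ge0.
  have m_i0 : measurable_fun setT (fun z : p.-tuple R => tnth z i0).
    exact: measurable_tnth.
  pose B (t : n.-tuple (p.-tuple R)) :=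
    \prod_(i < n) (tail (tnth (tnth t i) i0) * w f (tnth t i)).
  have mB : measurable_fun setT B.
    apply: (measurable_prod_tnth (h := fun z => tail (tnth z i0) * w f z)).
    by apply: measurable_funM => //; exact: (measurableT_comp mtail).
  have B0 t : 0 <= B t by apply: prodr_ge0 => i _; rewrite mulr_ge0.
  have intW : (\int[iid nu n]_t (\prod_(i < n) w f (tnth t i))%:E = 1)%E.
    rewrite (@integral_iid_prod _ _ _ _ _ _ 1) ?expr1n//.
    transitivity (\int[nu]_z (1 * w f z)%:E)%E.
      by under [RHS]eq_integral do rewrite mul1r.
    rewrite (@integral_w f (fun=> 1))//.
    exact: (integral_probability_cst (gauss R)).
  have intB : (\int[iid nu n]_t (B t)%:E = (c ^+ n)%:E)%E.
    apply: (@integral_iid_prod _ _ _ _ _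
      (fun z => tail (tnth z i0) * w f z)) => //.
    - by apply: measurable_funM => //; exact: (measurableT_comp mtail).
    - by move=> z; rewrite mulr_ge0.
    rewrite integral_w//.
    transitivity (\int[gauss R]_x (expR (- 2) * expR (4^-1 * x ^+ 2))%:E)%E.
      by apply: eq_integral => x _; rewrite -expRD addrC.
    rewrite ge0_integralZl_real ?expR_ge0//; last first.
      by apply: measurableT_comp => //; exact: measurable_funM.
    by rewrite integral_gauss_exp_sqr//; lra.
  (* [ge_1D] is integrated against the likelihood ratio of the star, which has mass one and leaves
     the law of the centre standard. *)
  have : (1 <= X + (c ^+ n)%:E)%E.
    rewrite -intW -intB /X -ge0_integralD_real//; last 2 first.
    - by apply: measurable_funM.
    - by move=> t; rewrite mulr_ge0// indicE.
    apply: ge0_le_integral => //.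
    - by move=> t _; rewrite lee_fin.
    - exact/measurable_EFinP.
    - by apply/measurable_EFinP; apply: measurable_funD => //; exact: measurable_funM.
    move=> t _; rewrite lee_fin /B big_split/= -mulrDl ler_peMl//.
  have X0 : (0 <= X)%E.
    by apply: integral_ge0 => t _; rewrite lee_fin mulr_ge0// indicE.
  case: X X0 => [x _| _ _|//]; last by rewrite leey.
  by rewrite -EFinD !lee_fin => ?; lra.
- move=> f g; set s := agree f g.
  pose la : R := s%:R * th.
  have la0 : 0 <= la by rewrite mulr_ge0.
  pose h (z : p.-tuple R) := expR (- la * tnth z i0 ^+ 2) * (w f z * w g z).
  have mh : measurable_fun setT h.
    apply: measurable_funM; last exact: measurable_funM.
    apply: measurableT_comp => //; apply: measurable_funM => //.
    by apply: measurable_funX; exact: measurable_tnth.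
  have h0 z : 0 <= h z by rewrite !mulr_ge0 ?expR_ge0.
  have intH : (\int[iid nu n]_t (\prod_(i < n) h (tnth t i))%:E =
      ((K ^+ s) ^+ n)%:E)%E.
    by apply: integral_iid_prod => //; exact: integral_ww.
  apply: (@le_trans _ _ (\int[iid nu n]_t
      (expR (8 * n%:R * la) * \prod_(i < n) h (tnth t i))%:E)%E).
    apply: ge0_le_integral => //.
    - by move=> t _; rewrite lee_fin !mulr_ge0// indicE.
    - apply/measurable_EFinP; apply: measurable_funM => //.
      exact: measurable_funM.
    - apply/measurable_EFinP; apply: measurable_funM => //.
      exact: measurable_prod_tnth.
    move=> t _; rewrite lee_fin /h !big_split/= [leRHS]mulrA ler_wpM2r ?mulr_ge0//.
    exact: le_1D.
  rewrite ge0_integralZl_real ?expR_ge0//; last 2 first.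
  - exact: measurable_prod_tnth.
  - by move=> t; apply: prodr_ge0.
  rewrite intH -EFinM lee_fin -exprM.
  apply: (@le_trans _ _ (expR (8 * n%:R * (s%:R * dl ^+ 2)) *
      expR (dl ^+ 2) ^+ (s * n))).
    apply: ler_pM; rewrite ?expR_ge0 ?exprn_ge0 ?(ltW K_gt0)//.
      by rewrite ler_expR ler_wpM2l ?mulr_ge0// ler_wpM2l.
    by rewrite lerXn2r ?nnegrE ?expR_ge0// ltW.
  rewrite -expRM_natl -expRD /Gb -expRM_natl ler_expR natrM.
  by rewrite le_eqVlt; apply/orP; left; apply/eqP; ring.
rewrite sum_agree// card_ffun !card_ord natrX.
have mR : 0 < m%:R :> R by rewrite ltr0n.
rewrite expr2 mulrCA ler_wpM2l ?exprn_ge0//.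
have Gb1 : 1 <= Gb.
  by rewrite /Gb -[leLHS]expR0 ler_expR; apply: mulr_ge0.
(* The average of [Gb ^ agree f g] is [(1 + (Gb - 1) / m) ^ k], at most the exponential of
   [k (Gb - 1) / m], which [chi_le] bounds by [expR 2]. *)
apply: (@le_trans _ _ ((m%:R * expR ((Gb - 1) / m%:R)) ^+ k)).
  rewrite lerXn2r ?nnegrE ?mulr_ge0 ?expR_ge0//; first lra.
  have -> : Gb + m%:R - 1 = m%:R * (1 + (Gb - 1) / m%:R).
    by field; rewrite gt_eqF.
  by rewrite ler_wpM2l// expR_ge1Dx.
rewrite exprMn mulrC ler_wpM2r ?exprn_ge0//.
by rewrite -expRM_natl ler_expR mulrA ler_pdivrMr.
Qed.

End star_bound.

(** * Pairs with one unknown stronger correlation *)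

Section pair_design.
Context (p K : nat).
Hypothesis K2p : (K + K <= p)%N.

(* The pairs are [(c, K + c)] for [c < K]; the coordinates from [2 K] on, of
   which there is at most one when [K = p / 2], are isolated. *)
Definition is_leaf (i : 'I_p) := (K <= i < K + K)%N.

Definition pair_par (i : 'I_p) : 'I_p :=
  if is_leaf i then Ordinal (leq_ltn_trans (leq_subr K i) (ltn_ord i)) else i.

Lemma pair_leaf_lt (c : 'I_K) : (K + c < p)%N.
Proof. by apply: leq_trans K2p; rewrite ltn_add2l. Qed.

Definition pair_leaf c : 'I_p := Ordinal (pair_leaf_lt c).

Lemma pair_leafP c : is_leaf (pair_leaf c).
Proof. by rewrite /is_leaf/= leq_addr ltn_add2l ltn_ord. Qed.

Lemma pair_leaf_inj : injective pair_leaf.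
Proof. by move=> c c' [] /addnI/val_inj. Qed.

Lemma pair_par_root i : is_leaf (pair_par i) = false.
Proof.
rewrite /pair_par; case: ifP => // /andP[Ki iK]; rewrite /is_leaf/=.
by rewrite leqNgt ltn_subLR// iK.
Qed.

Lemma pair_par_inj i j : is_leaf i -> is_leaf j ->
  pair_par i = pair_par j -> i = j.
Proof.
move=> li lj; rewrite /pair_par li lj => -[]; move: li lj.
move=> /andP[Ki _] /andP[Kj _] ij; apply: val_inj => /=.
by rewrite -(subnK Ki) ij subnK.
Qed.

End pair_design.

Section pair_bound.
Context (R : realType) (n p K : nat) (r q Rad rho d : R).
Hypotheses (K0 : (0 < K)%N) (K2p : (K + K <= p)%N).
Hypotheses (r0 : 0 < r) (q0 : 0 <= q).
Hypotheses (rho0 : 0 < rho) (d0 : 0 < d) (rhod : rho + d <= 2^-1).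
Hypothesis d_le : d <= 4^-1.
Hypothesis pair_le : 1 + (rho + d) `^ q <= Rad.
Hypothesis chi_le : expR (5 * n%:R * d ^+ 2) <= K%:R.
Notation nu := (iid (gauss R) p).
Notation par := (@pair_par p K).
Notation lf := (pair_leaf K2p).

Let b0 (i : 'I_p) : R := if is_leaf K i then rho else 0.
Let b1 (c : 'I_K) (i : 'I_p) : R := if i == lf c then rho + d else b0 i.

Let s0 : R := Num.sqrt (1 - rho ^+ 2).
Let s1 : R := Num.sqrt (1 - (rho + d) ^+ 2).
(* In terms of the innovations of the base law, the modified leaf is the affine
   image [beta z_par + sg z] of its innovation. *)
Let beta : R := d / s0.
Let sg : R := s1 / s0.

Let w (c : 'I_K) (z : p.-tuple R) : R :=
  leaf_ratio par (fun=> beta) (fun=> sg) (lf c) z.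

Let rho2_le : rho ^+ 2 <= 4^-1.
Proof.
have h : rho <= 2^-1 by move: rhod d0; lra.
by rewrite expr2; apply: le_trans (ler_pM (ltW rho0) (ltW rho0) h h) _; lra.
Qed.

Let rhod2_le : (rho + d) ^+ 2 <= 4^-1.
Proof.
have h : 0 <= rho + d by have := d0; have := rho0; lra.
by rewrite expr2; apply: le_trans (ler_pM h h rhod rhod) _; lra.
Qed.

Let s0_gt0 : 0 < s0.
Proof. by rewrite sqrtr_gt0; have := rho2_le; lra. Qed.

Let s1_gt0 : 0 < s1.
Proof. by rewrite sqrtr_gt0; have := rhod2_le; lra. Qed.

Let sg_gt0 : 0 < sg.
Proof. exact: divr_gt0. Qed.

Let s0E : s0 ^+ 2 = 1 - rho ^+ 2.
Proof. by rewrite sqr_sqrtr//; have := rho2_le; lra. Qed.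

Let s1E : s1 ^+ 2 = 1 - (rho + d) ^+ 2.
Proof. by rewrite sqr_sqrtr//; have := rhod2_le; lra. Qed.

(** The relative loss of conditional variance of the modified leaf, of order [d]. *)
Let tau : R := d * (2 * rho + d) / (1 - rho ^+ 2).

Let sgE : sg ^+ 2 = 1 - tau.
Proof.
rewrite /sg expr_div_n s0E s1E /tau; field.
by have := rho2_le; lra.
Qed.

Let tau_ge0 : 0 <= tau.
Proof.
have := d0; have := rho0 => *; apply: divr_ge0; last by have := rho2_le; lra.
by apply: mulr_ge0; lra.
Qed.

Let tau_le : tau <= 4 / 3 * d.
Proof.
rewrite ler_pdivrMr; last by have := rho2_le; lra.
rewrite (_ : 4 / 3 * d * _ = d * (4 / 3 * (1 - rho ^+ 2))); last by ring.
rewrite ler_wpM2l ?(ltW d0)//.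
by have := rho2_le; have := rhod; have := d0; lra.
Qed.

Let d2_le : d ^+ 2 <= 16^-1.
Proof.
by rewrite expr2; apply: le_trans (ler_pM (ltW d0) (ltW d0) d_le d_le) _; lra.
Qed.

Let tau2_le : tau ^+ 2 <= 2 * d ^+ 2.
Proof.
rewrite expr2; apply: le_trans (ler_pM _ _ tau_le tau_le) _ => //.
by have := sqr_ge0 d; rewrite expr2; lra.
Qed.

Let th : R := beta ^+ 2 / (2 - sg ^+ 2).

Let th_ge0 : 0 <= th.
Proof.
by apply: divr_ge0; [exact: sqr_ge0|rewrite sgE; have := tau_ge0; lra].
Qed.

Let th_le : th <= 3 / 2 * d ^+ 2.
Proof.
have d20 := sqr_ge0 d.
rewrite /th ler_pdivrMr; last by rewrite sgE; have := tau_ge0; lra.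
rewrite /beta expr_div_n s0E ler_pdivrMr; last by have := rho2_le; lra.
have h1 : 1 <= 2 - (1 - tau) by have := tau_ge0; lra.
have h2 : 3 / 4 <= 1 - rho ^+ 2 by have := rho2_le; lra.
have h0 : 0 <= 3 / 4 :> R by lra.
have h3 : 1 * (3 / 4) <= (2 - (1 - tau)) * (1 - rho ^+ 2) by apply: ler_pM.
rewrite sgE (_ : 3 / 2 * d ^+ 2 * _ * _ =
  d ^+ 2 * (3 / 2 * ((2 - (1 - tau)) * (1 - rho ^+ 2)))); last by ring.
by rewrite ler_peMr//; lra.
Qed.

Let b_par0 i : b0 (par i) = 0.
Proof. by rewrite /b0 pair_par_root. Qed.

Let par_lf c c' : par (lf c) != lf c'.
Proof.
by apply/eqP => /(congr1 (is_leaf K)); rewrite pair_par_root pair_leafP.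
Qed.

Let b_par1 c i : b1 c (par i) = 0.
Proof.
rewrite /b1 b_par0; case: eqP => // /(congr1 (is_leaf K)).
by rewrite pair_par_root pair_leafP.
Qed.

Let b0_ge0 i : 0 <= b0 i.
Proof. by rewrite /b0; case: ifP => // _; exact: ltW. Qed.

Let b0_le1 i : b0 i <= 1.
Proof. by rewrite /b0; case: ifP => // _; have := rhod; have := d0; lra. Qed.

Let b1_ge0 c i : 0 <= b1 c i.
Proof.
by rewrite /b1; case: ifP => // _; have := rho0; have := d0; lra.
Qed.

Let b1_le1 c i : b1 c i <= 1.
Proof. by rewrite /b1; case: ifP => // _; have := rhod; lra. Qed.

Let ell_base s : 0 <= s -> ell s (leaf_cov par b0) = 1 + rho `^ s.
Proof.
move=> s_ge0; pose c := Ordinal K0.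
have bc : b0 (lf c) = rho by rewrite /b0 pair_leafP.
rewrite -{1}bc; apply: ell_matching => //.
- by rewrite bc.
- by move=> i; rewrite bc /b0; case: ifP => // _; exact: ltW.
move=> i j; rewrite /b0; case: ifP => [li _|]; last by rewrite eqxx.
by case: ifP => [lj _|]; [exact: pair_par_inj|rewrite eqxx].
Qed.

Let ell_alt c s : 0 <= s -> ell s (leaf_cov par (b1 c)) = 1 + (rho + d) `^ s.
Proof.
move=> s_ge0; have bc : b1 c (lf c) = rho + d by rewrite /b1 eqxx.
have leaf i : b1 c i != 0 -> is_leaf K i.
  rewrite /b1 /b0; have [-> _|_] := eqVneq i (lf c); first exact: pair_leafP.
  by case: ifP => // _; rewrite eqxx.
rewrite -{1}bc; apply: ell_matching => //.
- by rewrite bc; have := rho0; have := d0; lra.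
- move=> i; rewrite bc /b1 /b0; case: ifP => // _.
  by case: ifP => // _; have := rho0; have := d0; lra.
by move=> i j /leaf li /leaf lj; exact: pair_par_inj.
Qed.

Let mw c : measurable_fun setT (w c).
Proof. by apply: measurable_leaf_ratio. Qed.

Let w0 c z : 0 <= w c z.
Proof. exact: leaf_ratio_ge0. Qed.

Let alt c (h : p.-tuple R -> \bar R) : measurable_fun setT h ->
  (forall z, 0 <= h z)%E ->
  (\int[nu]_z h (linmap (leaf_mx par (b1 c)) z) =
   \int[nu]_z (h (linmap (leaf_mx par b0) z) * (w c z)%:E))%E.
Proof.
move=> mh h0.
have sgp (j : 'I_p) : 0 < sg by exact: sg_gt0.
have mh' : measurable_fun setT (fun z => h (linmap (leaf_mx par b0) z)).
  by apply: (measurableT_comp mh); exact: measurable_linmap.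
transitivity (\int[nu]_z h (linmap (leaf_mx par b0)
    (shear par (fun=> beta) (fun=> sg) [:: lf c] z)))%E.
  apply: eq_integral => z _; congr h; apply: eq_from_tnth => j.
  rewrite !tnth_linmap_leaf_mx !tnth_mktuple !inE.
  have -> : (par j == lf c) = false.
    by apply/eqP => /(congr1 (is_leaf K)); rewrite pair_par_root pair_leafP.
  rewrite /b1; case: eqP => [->|//]; rewrite /b0 pair_leafP -/s0 -/s1.
  by rewrite /affine /beta /sg; field; rewrite gt_eqF.
rewrite (@integral_shear _ _ par (fun=> beta) (fun=> sg) sgp _
  (fun z => h (linmap (leaf_mx par b0) z)))//.
  by under eq_integral do rewrite big_seq1.
by move=> i; rewrite !inE => /eqP ->; exact: par_lf.
Qed.

Let integral_w c : (\int[nu]_z (w c z)%:E = 1)%E.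
Proof.
transitivity (\int[nu]_z (1 * (w c z)%:E))%E.
  by under [RHS]eq_integral do rewrite mul1e.
rewrite -(@alt c (fun=> 1%E))//.
exact: (integral_probability_cst nu).
Qed.

(** The product is itself the density of the shear that modifies both leaves. *)
Let integral_ww c c' : c != c' -> (\int[nu]_z (w c z * w c' z)%:E = 1)%E.
Proof.
move=> cc'; have sgp (j : 'I_p) : 0 < sg by exact: sg_gt0.
transitivity (\int[nu]_z (1 * (\prod_(j <- [:: lf c; lf c'])
    leaf_ratio par (fun=> beta) (fun=> sg) j z)%:E))%E.
  by apply: eq_integral => z _; rewrite mul1e big_cons big_seq1.
rewrite -(@integral_shear _ _ par (fun=> beta) (fun=> sg) sgp _ (fun=> 1%E))//.
- exact: (integral_probability_cst nu).
- by rewrite /= !inE andbT (inj_eq (@pair_leaf_inj _ _ _)).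
by move=> i; rewrite !inE => /orP[] /eqP ->; rewrite negb_or !par_lf.
Qed.

Let G1 : R := (sg * Num.sqrt (2 - sg ^+ 2))^-1 * (Num.sqrt (1 - 2 * th))^-1.

Let sg2 : sg ^+ 2 < 2.
Proof. by rewrite sgE; have := tau_ge0; lra. Qed.

Let th2 : th < 1 / 2.
Proof. by have := th_le; have := d2_le; lra. Qed.

(** Integrating out the leaf given its parent leaves a constant times the exponential of [th x ^ 2],
    which is then integrated over the parent. *)
Let integral_w2 c : (\int[nu]_z (w c z ^+ 2)%:E = G1%:E)%E.
Proof.
pose c0 : R := (sg * Num.sqrt (2 - sg ^+ 2))^-1.
have c0_ge0 : 0 <= c0 by rewrite invr_ge0 mulr_ge0 ?sqrtr_ge0// ltW.
pose h (j : 'I_p) x y := gauss_ratio (beta * x) sg y ^+ 2.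
pose H (j : 'I_p) (x : R) := c0 * expR (th * x ^+ 2).
have mH j : measurable_fun setT (H j).
  apply: measurable_funM => //; apply: measurableT_comp => //.
  exact: measurable_funM.
have H0 j x : 0 <= H j x by rewrite mulr_ge0 ?expR_ge0.
transitivity (\int[nu]_z (1 * \prod_(j <- [:: lf c]) h j (tnth z (par j)) (tnth z j))%:E)%E.
  by apply: eq_integral => z _; rewrite mul1r big_seq1.
rewrite (@integral_iid_out _ _ _ _ _ [:: lf c] par (fun=> 1) h H)//.
- under eq_integral do rewrite mul1r big_seq1.
  rewrite (@integral_iid_coord _ _ _ (gauss R) p (par (lf c))
    (fun x => (H (lf c) x)%:E)); last 2 first.
  + by apply/measurable_EFinP; exact: mH.
  + by move=> x; rewrite lee_fin.
  rewrite ge0_integralZl_real//; last first.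
    by apply: measurableT_comp => //; exact: measurable_funM.
  by rewrite integral_gauss_exp_sqr.
- by move=> i; rewrite !inE => /eqP ->; exact: par_lf.
- move=> j; apply: measurable_funX; apply: measurable_gauss_ratio => //.
  exact: measurable_funM.
- by move=> j x y; rewrite sqr_ge0.
move=> j x; rewrite integral_gauss_ratio_sqr//; congr EFin.
rewrite /H mulrC; congr (_ * expR _).
by rewrite /th exprMn mulrAC.
Qed.

Let G1_ge0 : 0 <= G1.
Proof.
apply: mulr_ge0; rewrite invr_ge0 ?sqrtr_ge0//.
by rewrite mulr_ge0 ?sqrtr_ge0// ltW.
Qed.

(** The first factor is the inverse of [sqrt (1 - tau ^ 2)] and costs [2 d ^ 2] in the exponent; the
    second costs [2 th <= 3 d ^ 2]. *)
Let G1_le : G1 <= expR (5 * d ^+ 2).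
Proof.
have -> : 5 * d ^+ 2 = 2 * d ^+ 2 + 3 * d ^+ 2 by ring.
rewrite expRD; apply: ler_pM.
- by rewrite invr_ge0 mulr_ge0 ?sqrtr_ge0// ltW.
- by rewrite invr_ge0 sqrtr_ge0.
- have -> : sg * Num.sqrt (2 - sg ^+ 2) = Num.sqrt (1 - tau ^+ 2).
    rewrite -[X in X * _](gtr0_norm sg_gt0) -sqrtr_sqr -sqrtrM ?sqr_ge0// sgE.
    by congr Num.sqrt; ring.
  apply: (le_trans (inv_sqrt_le_expR (sqr_ge0 _) _)).
    by have := tau2_le; have := d2_le; lra.
  by rewrite ler_expR.
apply: (le_trans (inv_sqrt_le_expR _ _)).
- by have := th_ge0; lra.
- by have := th_le; have := d2_le; lra.
by rewrite ler_expR; have := th_le; lra.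
Qed.

(** The truncation event is the whole space. Only the [K] diagonal terms of the second moment exceed
    1, each being at most [K] by [chi_le], so [C = 2] and the denominator is [8 * 3]. *)
Lemma pair_bound (L : n.-tuple (p.-tuple R) -> R) : measurable_fun setT L ->
  ((((rho + d) `^ r - rho `^ r) ^+ 2 / 24)%:E <= max_risk r q Rad L)%E.
Proof.
move=> mL.
have rd0 : 0 <= rho + d by have := rho0; have := d0; lra.
have indT (t : n.-tuple (p.-tuple R)) : \1_[set: n.-tuple (p.-tuple R)] t = 1 :> R.
  by rewrite indicT.
have base_le : 1 + rho `^ q <= Rad.
  apply: le_trans pair_le; rewrite lerD2l; apply: ge0_ler_powR => //.
  - by rewrite nnegrE ltW.
  - by have := d0; lra.
have := @max_risk_le_cam R n p r q Rad (leaf_mx par b0) _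
  (fun c => leaf_mx par (b1 c)) w setT (1 + (rho + d) `^ r) 2
  (fun c c' => if c == c' then expR (5 * n%:R * d ^+ 2) else 1).
rewrite -/(leaf_cov par b0) ell_base ?(ltW r0)//.
have -> : 1 + (rho + d) `^ r - (1 + rho `^ r) = (rho + d) `^ r - rho `^ r by ring.
have -> : 8 * (1 + 2) = 24 :> R by ring.
apply => //.
- by rewrite card_ord.
- by apply: leaf_cov_in_G => //; rewrite ell_base.
- by move=> c; apply: leaf_cov_in_G => //; rewrite ell_alt.
- by move=> c; rewrite -/(leaf_cov par (b1 c)) ell_alt// ltW.
- move=> c; under eq_integral do rewrite indT mul1r.
  rewrite (integral_iid_prod _ (mw c) (w0 c) (integral_w c)) expr1n lee_fin.
  by lra.
- move=> c c'; under eq_integral do rewrite indT mul1r -big_split/=.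
  have mww : measurable_fun setT (fun z => w c z * w c' z) by exact: measurable_funM.
  have ww0 z : 0 <= w c z * w c' z by rewrite mulr_ge0.
  case: eqP => [cc|/eqP cc].
    rewrite (integral_iid_prod (c := G1) _ mww ww0); last first.
      by rewrite cc; exact: integral_w2.
    rewrite lee_fin (_ : 5 * _ * _ = n%:R * (5 * d ^+ 2)); last by ring.
    by rewrite expRM_natl lerXn2r ?nnegrE ?expR_ge0.
  by rewrite (integral_iid_prod _ mww ww0 (integral_ww cc)) expr1n.
rewrite card_ord.
apply: (@le_trans _ _ (\sum_(c < K) (K%:R + K%:R))); last first.
  by rewrite sumr_const card_ord -mulr_natl; rewrite expr2; lra.
apply: ler_sum => c _; rewrite (bigD1 c)//= eqxx; apply: lerD => //.
under eq_bigr => c' /negbTE cc' do rewrite eq_sym cc'.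
rewrite sumr_const ler_nat.
by apply: (leq_trans (max_card _)); rewrite card_ord.
Qed.

End pair_bound.

(** * Choice of the parameters *)

(** A nonzero off-diagonal entry adds a positive amount to its row sum, and exactly 1 when [q = 0].
    This is the room used by both families. *)
Lemma class_radius (R : realType) (p : nat) (q Rad : R) (Sigma : 'M[R]_p) :
  0 <= q -> G q Rad Sigma -> Sigma <> 1%:M -> 1 < Rad /\ (q = 0 -> 2 <= Rad).
Proof.
move=> q0 [_ le_Rad diag1] neq1.
have diagE i : Sigma i i = 1.
  by have := congr1 (fun A : 'M[R]_p => A i i) diag1; rewrite !mxE eqxx.
have [i [j [ij Sij]]] : exists i j, i != j /\ Sigma i j != 0.
  apply: contrapT => none; apply: neq1; apply/matrixP => i j; rewrite mxE.
  have [->|ij] := eqVneq i j; first by rewrite diagE.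
  by apply/eqP; apply: contraT => Sij; case: none; exists i, j.
have row_le : 1 + abs_pow q (Sigma i j) <= Rad.
  apply: le_trans le_Rad.
  apply: (@le_trans _ _ (\sum_k abs_pow q (Sigma i k))); last exact: (le_bigmax _ _ i).
  rewrite (bigD1 i)//= (bigD1 j)/=; last by rewrite eq_sym.
  rewrite diagE abs_pow1 addrA lerDl; apply: sumr_ge0 => k _; exact: abs_pow_ge0.
have absE : abs_pow q (Sigma i j) = `|Sigma i j| `^ q by rewrite /abs_pow (negbTE Sij).
split; last by move=> q_eq0; move: row_le; rewrite absE q_eq0 powRr0; lra.
have : 0 < abs_pow q (Sigma i j) by rewrite absE powR_gt0 ?normr_gt0.
by lra.
Qed.

(** With [y = Rad - 1], a single correlation up to [x0] fits in the class. For [q = 0] its power is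
    1 however small it is, whence the condition on [y]. *)
Lemma small_power (R : realType) (q y : R) : 0 <= q -> 0 < y -> (q = 0 -> 1 <= y) ->
  exists x0 : R, [/\ 0 < x0, x0 <= 2^-1 &
    forall x, 0 <= x -> x <= x0 -> x `^ q <= y].
Proof.
move=> q0 y0 qy; have [q_eq0|q1] := eqVneq q 0.
  exists 2^-1; split => // x _ _; rewrite q_eq0 powRr0; exact: qy.
have q_gt0 : 0 < q by rewrite lt_neqAle eq_sym q1.
exists (Num.min 2^-1 (y `^ q^-1)); split.
- by rewrite lt_min powR_gt0// andbT invr_gt0.
- by rewrite ge_min lexx.
move=> x x0; rewrite le_min => /andP[_ xy].
have -> : y = (y `^ q^-1) `^ q.
  by rewrite -powRrM mulVf// powRr1// ltW.
by apply: ge0_ler_powR; rewrite ?nnegrE ?powR_ge0// ltW.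
Qed.

(** With [t = d / x <= 1], one has [(1 + t) ^ r - 1 >= r ln (1 + t) >= r t / 2]; this is uniform in
    [r], which may be below or above 1. *)
Lemma powR_increment (R : realType) (r x d : R) : 0 < r -> 0 < x -> 0 <= d ->
  d <= x -> x `^ r * (r * (d / x) / 2) <= (x + d) `^ r - x `^ r.
Proof.
move=> r0 x0 d0 dx; set t := d / x.
have t0 : 0 <= t by rewrite divr_ge0// ltW.
have t1 : t <= 1 by rewrite ler_pdivrMr// mul1r.
have -> : x + d = x * (1 + t) by rewrite /t; field; rewrite gt_eqF.
rewrite powRM ?(ltW x0)//; last by lra.
have -> : x `^ r * (1 + t) `^ r - x `^ r = x `^ r * ((1 + t) `^ r - 1) by ring.
apply: ler_wpM2l; first exact: powR_ge0.
have ln_ge : t / 2 <= ln (1 + t).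
  have := @le_ln1Dx R (- (t / (1 + t))).
  have -> : 1 + - (t / (1 + t)) = (1 + t)^-1 by field; lra.
  rewrite lnV ?posrE; last by lra.
  have h1 : t / 2 <= t / (1 + t).
    by rewrite ler_wpM2l// lef_pV2 ?posrE; lra.
  have h2 : t / (1 + t) <= 2^-1.
    by rewrite ler_pdivrMr; lra.
  move=> h; have := h _; lra.
rewrite /powR gt_eqF; last by lra.
apply: (@le_trans _ _ (r * ln (1 + t))); first by rewrite -mulrA ler_wpM2l// ltW.
by have := expR_ge1Dx (r * ln (1 + t)); lra.
Qed.

(** With [K] the half of [p], rounded down, [p <= 2 K + 1 <= 4 K <= K ^ 3]. *)
Lemma ln_le_ln_half (R : realType) (p : nat) : (4 <= p)%N ->
  ln p%:R <= 3 * ln (p./2)%:R :> R.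
Proof.
move=> p4; set K := p./2.
have K2 : (2 <= K)%N by rewrite (half_leq p4).
have K0 : (0 < K)%N by exact: leq_trans K2.
have p0 : (0 < p)%N by exact: leq_trans p4.
rewrite mulr_natl -lnXn ?ltr0n// ler_ln ?posrE ?exprn_gt0 ?ltr0n//.
rewrite -natrX ler_nat -(odd_double_half p) -/K -addnn.
have K4 : (2 ^ 2 <= K ^ 2)%N by rewrite leq_exp2r.
apply: (@leq_trans (K * 4)); last by rewrite expnS leq_mul2l K4 orbT.
rewrite (_ : K * 4 = K + K + (K + K))%N; last by rewrite !mulnS muln0 addn0 !addnA.
rewrite leq_add2r; apply: leq_trans (leq_b1 _) _.
by rewrite addn_gt0 (leq_trans _ K2).
Qed.

Lemma log_bound (R : realType) (r q Rad x0 : R) : 0 < r -> 0 <= q ->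
  0 < x0 -> x0 <= 2^-1 -> (forall x, 0 <= x -> x <= x0 -> x `^ q <= Rad - 1) ->
  exists2 B : R, 0 < B & forall n p (L : n.-tuple (p.-tuple R) -> R),
    (0 < n)%N -> (4 <= p)%N -> 2 * ln p%:R < n%:R :> R -> measurable_fun setT L ->
    ((B * (ln p%:R / n%:R))%:E <= max_risk r q Rad L)%E.
Proof.
(* With [d ^ 2 = c ln p / n], the choice of [c] gives [d <= rho], so that [rho + d <= x0], and
   [5 c <= 1 / 3], so that [5 n d ^ 2] is at most the logarithm of the number of pairs. *)
move=> r0 q0 x0_gt0 x0_le x0P; pose rho := x0 / 2; pose c := x0 ^+ 2 / 15.
have rho0 : 0 < rho by rewrite divr_gt0.
have c0 : 0 < c by rewrite divr_gt0 ?exprn_gt0.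
pose kap := rho `^ r * (r / rho / 2).
have kap0 : 0 < kap by rewrite mulr_gt0 ?powR_gt0// !divr_gt0.
exists (kap ^+ 2 * c / 24); first by rewrite divr_gt0// mulr_gt0// exprn_gt0.
move=> n p L n0 p4 ln_lt mL; set h := ln p%:R / n%:R.
have nR : 0 < n%:R :> R by rewrite ltr0n.
have ln0 : 0 < ln p%:R :> R by rewrite ln_gt0// ltr1n (leq_trans _ p4).
have h0 : 0 < h by rewrite divr_gt0.
have h_le : h <= 2^-1 by rewrite ler_pdivrMr//; lra.
pose d := Num.sqrt (c * h).
have d2 : d ^+ 2 = c * h by rewrite sqr_sqrtr// ltW// mulr_gt0.
have d0 : 0 < d by rewrite sqrtr_gt0 mulr_gt0.
have d_rho : d <= rho.
  rewrite -(@ler_pXn2r _ 2) ?nnegrE ?ltW// d2 /rho /c expr_div_n.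
  have := ler_wpM2l (ltW c0) h_le; rewrite /c.
  have := exprn_gt0 2 x0_gt0; set y := x0 ^+ 2; rewrite !expr2; lra.
have rhod : rho + d <= x0 by move: d_rho; rewrite /rho; lra.
have K0 : (0 < p./2)%N by rewrite (@half_gt0 p) (leq_trans _ p4).
have K2p : (p./2 + p./2 <= p)%N.
  by rewrite addnn -[leqRHS]odd_double_half leq_addl.
have chi : expR (5 * n%:R * d ^+ 2) <= (p./2)%:R.
  rewrite -[leRHS]lnK ?posrE ?ltr0n// ler_expR d2.
  have -> : 5 * n%:R * (c * h) = 5 * c * ln p%:R.
    by rewrite /h; field; rewrite gt_eqF.
  have c_le : 5 * c <= 3^-1.
    have := ler_pM (ltW x0_gt0) (ltW x0_gt0) x0_le x0_le.
    by rewrite /c -expr2; lra.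
  have := ler_wpM2r (ltW ln0) c_le; have := @ln_le_ln_half R p p4; lra.
have := @pair_bound R n p p./2 r q Rad rho d K0 K2p r0 q0 rho0 d0.
move=> /(_ (le_trans rhod x0_le)).
have d4 : d <= 4^-1 by move: d_rho; rewrite /rho; lra.
move=> /(_ d4).
have rhod0 : 0 <= rho + d by rewrite addr_ge0// ltW.
have le_Rad : 1 + (rho + d) `^ q <= Rad by have := x0P _ rhod0 rhod; lra.
move=> /(_ le_Rad chi L mL); apply: le_trans; rewrite lee_fin.
have -> : kap ^+ 2 * c / 24 * h = (kap * d) ^+ 2 / 24.
  by rewrite [in RHS]exprMn d2; ring.
rewrite ler_wpM2r ?invr_ge0// lerXn2r ?nnegrE//.
- by rewrite mulr_ge0// ltW.
- by rewrite subr_ge0 ge0_ler_powR ?nnegrE ?lerDl// ltW.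
apply: le_trans (powR_increment r0 rho0 (ltW d0) d_rho).
by rewrite /kap le_eqVlt; apply/orP; left; apply/eqP; field; rewrite gt_eqF.
Qed.

Lemma sparse_bound (R : realType) (r q Rad x0 : R) : 0 < r -> 0 <= q -> q < r ->
  1 < Rad -> 0 < x0 -> x0 <= 2^-1 ->
  (forall x, 0 <= x -> x <= x0 -> x `^ q <= Rad - 1) ->
  exists2 B : R, 0 < B & forall n p (L : n.-tuple (p.-tuple R) -> R),
    (0 < n)%N -> (0 < p)%N -> 2 * ln p%:R < n%:R :> R ->
    2 < (p%:R - 1) / (Rad ^+ 2 * n%:R `^ q) -> measurable_fun setT L ->
    ((B * (ln ((p%:R - 1) / (Rad ^+ 2 * n%:R `^ q) + 1) / (2 * n%:R)) `^ (r - q))%:E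
     <= max_risk r q Rad L)%E.
Proof.
(* With [dl ^ 2 = c h], this gives [dl <= x0] and [9 n dl ^ 2 <= ln (X + 1)]. About [kap / dl ^ q]
   leaves then separate the functionals by order [dl ^ (r - q)], whose square has order
   [h ^ (r - q)]. *)
move=> r0 q0 qr Rad1 x0_gt0 x0_le x0P; pose c := x0 ^+ 2 / 2.
have c0 : 0 < c by rewrite divr_gt0 ?exprn_gt0.
(* The first bound keeps the star in the class; the second, with [h >= 1 / (4 n)], gives
   [y ^ 2 <= n ^ q]. *)
pose kap := Num.min (Rad - 1) ((c / 4) `^ (q / 2)).
have kap0 : 0 < kap.
  by rewrite lt_min subr_gt0 Rad1 powR_gt0// divr_gt0.
pose e := 8 * (1 + expR 2) : R.
have e0 : 0 < e by rewrite mulr_gt0// addr_gt0 ?expR_gt0.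
exists ((kap / 2) ^+ 2 * c `^ (r - q) / e).
  by rewrite divr_gt0// mulr_gt0 ?powR_gt0// exprn_gt0// divr_gt0.
move=> n p L n0 p0 ln_lt X2 mL.
set X := (p%:R - 1) / _ in X2 *; set h := ln (X + 1) / _.
have nR : 0 < n%:R :> R by rewrite ltr0n.
have n1 : 1 <= n%:R :> R by rewrite ler1n.
have nq1 : 1 <= n%:R `^ q :> R.
  by rewrite -[leLHS](powRr0 (n%:R : R)); exact: ler_powR.
have Rad2 : 1 <= Rad ^+ 2 by rewrite expr_ge1// ltW// (lt_trans _ Rad1).
have RN1 : 1 <= Rad ^+ 2 * n%:R `^ q.
  by have := ler_pM ler01 ler01 Rad2 nq1; rewrite mulr1.
have RN0 : 0 < Rad ^+ 2 * n%:R `^ q by apply: lt_le_trans RN1.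
have XE : X * (Rad ^+ 2 * n%:R `^ q) = p%:R - 1 by rewrite /X divfK// gt_eqF.
have X0 : 0 < X by apply: lt_trans X2.
have X_le : X <= p%:R - 1 by rewrite -XE ler_peMr// ltW.
have pR : 3 < p%:R :> R by lra.
have eta_le : ln (X + 1) <= ln p%:R.
  by rewrite ler_ln ?posrE; lra.
have eta_ge : 2^-1 <= ln (X + 1).
  have := @le_ln1Dx R (- (X / (1 + X))).
  have -> : 1 + - (X / (1 + X)) = (X + 1)^-1 by field; lra.
  rewrite lnV ?posrE; last by lra.
  have h1 : 2^-1 <= X / (1 + X) by rewrite ler_pdivlMr; lra.
  have h2 : X / (1 + X) < 1 by rewrite ltr_pdivrMr; lra.
  by move=> H; have := H _; lra.
have h0 : 0 < h by rewrite divr_gt0 ?mulr_gt0//; lra.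
have h_le : h <= 4^-1 by rewrite ler_pdivrMr ?mulr_gt0//; lra.
have h_ge : (4 * n%:R)^-1 <= h.
  rewrite ler_pdivlMr ?mulr_gt0//.
  have -> : (4 * n%:R)^-1 * (2 * n%:R) = 2^-1 :> R by field; rewrite gt_eqF.
  exact: eta_ge.
pose dl := Num.sqrt (c * h).
have dl2 : dl ^+ 2 = c * h by rewrite sqr_sqrtr// ltW// mulr_gt0.
have dl0 : 0 < dl by rewrite sqrtr_gt0 mulr_gt0.
have dl_x0 : dl <= x0.
  rewrite -(@ler_pXn2r _ 2) ?nnegrE ?(ltW x0_gt0) ?(ltW dl0)// dl2.
  have := ler_wpM2l (ltW c0) h_le; rewrite /c.
  by have := exprn_gt0 2 x0_gt0; set y := x0 ^+ 2; lra.
have dlE s : dl `^ s = (c * h) `^ (s / 2).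
  by rewrite -dl2 -powR_mulrn ?(ltW dl0)// -powRrM; congr (_ `^ _); field.
have dlq0 : 0 < dl `^ q by rewrite powR_gt0.
pose y := kap / dl `^ q.
have y0 : 0 < y by rewrite divr_gt0.
have y2_le : y ^+ 2 <= n%:R `^ q.
  have kap_le : kap <= (c / 4) `^ (q / 2) by rewrite ge_min lexx orbT.
  have : y <= n%:R `^ (q / 2).
    rewrite ler_pdivrMr// (le_trans kap_le)// dlE -powRM ?(ltW nR)//; last first.
      by rewrite mulr_ge0// ltW.
    have c4 : 0 <= c / 4 by apply: ltW; rewrite divr_gt0.
    have nch : 0 <= n%:R * (c * h) by exact: ltW (mulr_gt0 nR (mulr_gt0 c0 h0)).
    have q2 : 0 <= q / 2 by rewrite divr_ge0.
    apply: ge0_ler_powR; rewrite ?nnegrE//.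
    have := ler_wpM2l (ltW (mulr_gt0 nR c0)) h_ge.
    have -> : n%:R * c / (4 * n%:R) = c / 4 by field; rewrite gt_eqF.
    by rewrite -mulrA.
  have -> : n%:R `^ q = (n%:R `^ (q / 2)) ^+ 2 :> R.
    by rewrite -powR_mulrn ?powR_ge0// -powRrM; congr (_ `^ _); field.
  by move=> yn; rewrite lerXn2r ?nnegrE ?powR_ge0// ltW.
(* The number of leaves is the largest one allowed by the radius, up to a
   constant, but [k ^ 2 <= n ^ q] is what leaves room for blocks of size
   [m >= (p - 1) / 2 k]. *)
pose k := maxn 1 (Num.truncn y).
have k1 : (1 <= k)%N by rewrite leq_max.
have kR : 1 <= k%:R :> R by rewrite ler1n.
(* When [y < 1] a single leaf is used, which is admissible because [dl <= x0]. *)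
have k_cases : k%:R = 1 :> R \/ k%:R <= y.
  rewrite /k; case: (leqP 1 (Num.truncn y)) => [le1|lt1].
    by right; rewrite truncn_le ltW.
  by left.
have y_lt : y / 2 <= k%:R.
  have : y < k%:R + 1.
    apply: lt_le_trans (truncnS_gt y) _.
    by rewrite -natr1 lerD2r ler_nat leq_max leqnn orbT.
  by lra.
have k2_le : k%:R ^+ 2 <= n%:R `^ q :> R.
  case: k_cases => [->|ky]; first by rewrite expr1n.
  by apply: le_trans y2_le; rewrite lerXn2r ?nnegrE// ltW.
have star_le : 1 + k%:R * dl `^ q <= Rad.
  have : k%:R * dl `^ q <= Rad - 1; last by lra.
  case: k_cases => [->|ky]; first by rewrite mul1r x0P// ltW.
  apply: (@le_trans _ _ kap); last by rewrite ge_min lexx.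
  by rewrite -ler_pdivlMr.
have k2X : k%:R ^+ 2 * X <= p%:R - 1.
  rewrite -XE mulrC; apply: ler_wpM2l; first exact: ltW.
  by apply: le_trans k2_le _; rewrite ler_peMl// (le_trans ler01 nq1).
have k_le : k%:R * 2 <= p%:R - 1 :> R.
  apply: le_trans k2X; apply: ler_pM; rewrite ?(ltW X2)//.
  by rewrite expr2 ler_peMr// (le_trans ler01 kR).
(* One coordinate is reserved for the centre, and the rest is divided into [k] blocks, up to a
   remainder. *)
pose m := (p.-1 %/ k)%N.
have p1E : p.-1%:R = p%:R - 1 :> R by rewrite -subn1 natrB.
have m0 : (0 < m)%N.
  rewrite divn_gt0// -(ler_nat R) p1E; apply: le_trans k_le.
  by rewrite ler_peMr// ?ler1n// (le_trans ler01 kR).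
have kmp : (k * m < p)%N.
  by rewrite mulnC (leq_ltn_trans (leq_trunc_div _ _))// ltn_predL.
have m_ge : p%:R - 1 <= 2 * (k%:R * m%:R) :> R.
  rewrite -p1E -natrM -natrM ler_nat.
  have lt_k : (p.-1 %% k < k)%N by rewrite ltn_mod.
  rewrite {1}(divn_eq p.-1 k) -/m mul2n -addnn (mulnC m k) leq_add2l.
  by apply: leq_trans (ltnW lt_k) _; rewrite leq_pmulr.
have chi_le : k%:R * (expR (9 * n%:R * dl ^+ 2) - 1) <= 2 * m%:R.
  have exp_le : expR (9 * n%:R * dl ^+ 2) <= X + 1.
    rewrite -[leRHS]lnK ?posrE; last by lra.
    rewrite ler_expR dl2 /h.
    have -> : 9 * n%:R * (c * (ln (X + 1) / (2 * n%:R))) = 9 * c / 2 * ln (X + 1).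
      by field; rewrite gt_eqF.
    have c_le : 9 * c / 2 <= 1.
      have := ler_pM (ltW x0_gt0) (ltW x0_gt0) x0_le x0_le.
      by rewrite /c -expr2; lra.
    by rewrite ler_piMl//; lra.
  (* After multiplication by [k], the claim follows from [k ^ 2 X <= p - 1 <= 2 k m]. *)
  apply: (@le_trans _ _ (k%:R * X)).
    by apply: ler_wpM2l; [exact: (le_trans ler01 kR)|lra].
  rewrite -(@ler_pM2l _ k%:R); last exact: (lt_le_trans ltr01 kR).
  rewrite mulrA -expr2 (le_trans k2X)// (le_trans m_ge)//.
  by rewrite le_eqVlt; apply/orP; left; apply/eqP; ring.
have := @star_bound R n p k m r q Rad dl n0 m0 kmp r0 q0 dl0
  (le_trans dl_x0 x0_le) star_le chi_le L mL.
apply: le_trans; rewrite lee_fin -/e mulrAC ler_wpM2r ?invr_ge0 ?(ltW e0)//.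
have -> : (kap / 2) ^+ 2 * c `^ (r - q) * h `^ (r - q) =
    (y / 2 * dl `^ r) ^+ 2.
  rewrite -mulrA -powRM ?(ltW c0) ?(ltW h0)//.
  have -> : (c * h) `^ (r - q) = (dl `^ (r - q)) ^+ 2.
    rewrite dlE -powR_mulrn ?powR_ge0// -powRrM; congr (_ `^ _); by field.
  rewrite -exprMn; congr (_ ^+ 2).
  have -> : dl `^ (r - q) = dl `^ r / dl `^ q.
    by rewrite powRB// (gt_eqF dl0) implybT.
  by rewrite /y; field; rewrite gt_eqF.
have y2_ge0 : 0 <= y / 2 by apply: ltW; rewrite divr_gt0.
have dlr0 : 0 <= dl `^ r by exact: powR_ge0.
apply: lerXn2r; rewrite ?nnegrE; first exact: mulr_ge0.
  exact: mulr_ge0.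
exact: ler_wpM2r.
Qed.

Theorem theorem4p1 (R : realType) (r q Rad : R)
    (hr : 0 < r) (hq0 : 0 <= q) (hqr : q < r) (hRad : 0 < Rad) :
  exists2 C4 : R, 0 < C4 &
    forall n p : nat, (0 < n)%N -> (0 < p)%N ->
      (* if the class is empty or {I}, then the minimax risk is not positive *)
      (exists2 Sigma : 'M[R]_p, G q Rad Sigma & Sigma <> 1%:M) ->
      2 * ln p%:R < n%:R :> R ->
      Rad ^+ 2 < (p%:R - 1) * n%:R `^ (- q) / 2 ->
      ((C4 * phi n p r q Rad)%:E <= minimax_risk n p r q Rad)%E.
Proof.
have [[Rad1 Rad2]|none] := pselect (1 < Rad /\ (q = 0 -> 2 <= Rad)); last first.
  (* For such a radius the class contains no matrix other than the identity, and any constant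
     serves. *)
  exists 1 => // n p _ _ [Sigma GS S1] _ _.
  by case: none; exact: class_radius GS S1.
have y0 : 0 < Rad - 1 by lra.
have qy : q = 0 -> 1 <= Rad - 1 by move=> /Rad2; lra.
have [x0 [x0_gt0 x0_le x0P]] := small_power hq0 y0 qy.
have [B1 B10 B1P] := log_bound hr hq0 x0_gt0 x0_le x0P.
have [B2 B20 B2P] := sparse_bound hr hq0 hqr Rad1 x0_gt0 x0_le x0P.
have RR0 : 0 < Rad ^+ 2 by rewrite exprn_gt0.
(* Both terms of [phi] carry a factor [Rad ^ 2], which the division cancels; [B1] and [B2] depend on
   [r], [q] and [Rad] only. *)
exists (Num.min B1 B2 / Rad ^+ 2); first by rewrite divr_gt0// lt_min B10.
move=> n p n0 p0 _ ln_lt Rad_lt.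
have nR : 0 < n%:R :> R by rewrite ltr0n.
have nq0 : 0 < n%:R `^ q :> R by rewrite powR_gt0.
have nq1 : 1 <= n%:R `^ q :> R.
  by rewrite -[leLHS](powRr0 (n%:R : R)); apply: ler_powR => //; rewrite ler1n.
have RN0 : 0 < Rad ^+ 2 * n%:R `^ q by rewrite mulr_gt0.
have X2 : 2 < (p%:R - 1) / (Rad ^+ 2 * n%:R `^ q).
  rewrite ltr_pdivlMr// mulrC mulrAC -ltr_pdivlMr// -ltr_pdivlMr//.
  by rewrite -powRN.
have p4 : (4 <= p)%N.
  have Rad2_ge : 1 <= Rad ^+ 2 by rewrite expr_ge1// ltW// (lt_trans _ Rad1).
  have : 2 < p%:R - 1 :> R.
    apply: lt_le_trans X2 _; rewrite ler_pdivrMr//.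
    have p1 : 0 <= p%:R - 1 :> R by rewrite subr_ge0 ler1n.
    rewrite ler_peMr//.
    by have := ler_pM ler01 ler01 Rad2_ge nq1; rewrite mulr1.
  by rewrite ltrBrDr natr1 ltr_nat.
apply/ereal_infP => _ [L /= mL <-].
pose a : R := ln p%:R / n%:R.
pose h : R :=
  (ln ((p%:R - 1) / (Rad ^+ 2 * n%:R `^ q) + 1) / (2 * n%:R)) `^ (r - q).
have a0 : 0 <= a by rewrite divr_ge0// ln_ge0// ler1n.
have h0 : 0 <= h by exact: powR_ge0.
have [min1 min2] : Num.min B1 B2 <= B1 /\ Num.min B1 B2 <= B2.
  by rewrite !ge_min !lexx orbT.
have divE x : Num.min B1 B2 / Rad ^+ 2 * (Rad ^+ 2 * x) = Num.min B1 B2 * x.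
  by field; rewrite gt_eqF.
rewrite /phi -/a -/h; set b := Num.min (Rad ^+ 2 * h) _.
(* The larger term of [phi] is bounded by its own family; the sparse one is replaced by the first
   argument of its minimum, which dominates it. *)
have [ab|ba] := leP (Rad ^+ 2 * a) b.
  apply: le_trans (B2P n p L n0 p0 ln_lt X2 mL); rewrite lee_fin -/h.
  apply: (@le_trans _ _ (Num.min B1 B2 / Rad ^+ 2 * (Rad ^+ 2 * h))).
    by rewrite ler_wpM2l ?ge_min ?lexx// divr_ge0 ?(ltW RR0)// le_min !ltW.
  by rewrite divE ler_wpM2r.
apply: le_trans (B1P n p L n0 p4 ln_lt mL); rewrite lee_fin -/a.
by rewrite divE ler_wpM2r.
Qed.
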